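(* Let $\mathcal N$ be an infinite set of positive integers and define $$\kappa_{\mathcal N}(t):=\sup_{n\in\mathcal N}\frac{[-\log(2\cos nt)]_+}{n}\in[0,\infty]\qquad(t\in\mathbb R),$$ where $[x]_+=\max\{x,0\}$ and the expression is defined to be $+\infty$ if $\cos(nt)\le0$ for at least one $n\in\mathcal N$. The following assertions are equivalent. (i) Every normal contraction $T$ on a complex Hilbert space such that $$\sigma(T)\cap\mathbb T\subset\{1\},\qquad\sup_{n\in\mathcal N}\|I-T^n\|\le1$$ is a Ritt operator. (ii) The same assertion holds for diagonal contractions on $\ell^2$. (iii) The function $\kappa_{\mathcal N}$ satisfies $$\liminf_{t\downarrow0}\frac{\kappa_{\mathcal N}(t)}{t}>0,$$ where the value $+\infty$ is allowed. If condition (iii) fails, there is a diagonal contraction $T$ on $\ell^2$ with $\sigma(T)\cap\mathbb T\subset\{1\}$ and $\sup_{n\in\mathcal N}\|I-T^n\|=1$ exactly which is not a Ritt operator.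
   Context: $\mathbb D$ is the open unit disc, $\mathbb T$ the unit circle. A bounded operator $T$ is a Ritt operator if $\sigma(T)\subset\overline{\mathbb D}$ and $\sup_{|\lambda|>1}|\lambda-1|\,\|(\lambda-T)^{-1}\|<\infty$. A diagonal contraction on $\ell^2$ is an operator $Te_j=z_je_j$ with respect to the standard basis, with $|z_j|\le1$ for all $j$. *)

(* Defs.v *)
From HB Require Import structures.
From mathcomp Require Import all_boot all_order all_algebra.
From mathcomp Require Import complex ring lra.
From mathcomp Require Import all_classical all_reals all_analysis.

Set Implicit Arguments.
Unset Strict Implicit.
Unset Printing Implicit Defensive.

Import Order.TTheory GRing.Theory Num.Theory.
Import numFieldNormedType.Exports.

Local Open Scope classical_set_scope.
Local Open Scope ring_scope.
Local Open Scope complex_scope.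

(* A complex Hilbert space is a complete normed module over R[i] whose norm
   comes from a positive definite Hermitian form, linear in its first argument *)
HB.mixin Record CompleteNormedModule_isHilbert (R : realType) H
    & CompleteNormedModule R[i] H := {
  inner : {dot H for (@Num.conj R[i])} ;
  norm_inner : forall x : H, `|x| ^+ 2 = inner x x
}.

#[short(type="hilbertType")]
HB.structure Definition Hilbert (R : realType) :=
  { H of CompleteNormedModule R[i] H & CompleteNormedModule_isHilbert R H }.

(* Norms of normed modules over R[i] take values in R[i]; rnorm is the same
   norm with values in R *)
Definition rnorm {R : realType} {V : normedZmodType R[i]} (x : V) : R :=
  complex.Re `|x|.

Section operators.
Context {R : realType} {H : hilbertType R}.
Implicit Types (S T : H -> H) (z : R[i]).

Definition opnorm T : \bar R :=
  ereal_sup [set (rnorm (T x))%:E | x in [set x : H | `|x| <= 1]].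

(* S is the inverse of z - T in the algebra of bounded operators *)
Definition is_resolvent T z S : Prop :=
  [/\ linear S, (opnorm S < +oo)%E,
      cancel S (fun x => z *: x - T x) & cancel (fun x => z *: x - T x) S].

Definition spectrum T : set R[i] := [set z | ~ exists S, is_resolvent T z S].

(* The inverse of z - T if z is outside spectrum T, the zero map otherwise *)
Definition resolvent T z : H -> H := xget (fun=> 0) (is_resolvent T z).

Definition ritt (T : {linear H -> H}) : Prop :=
  [/\ (opnorm T < +oo)%E,
      spectrum T `<=` [set z | `|z| <= 1] &
      (ereal_sup [set (rnorm (z - 1))%:E * opnorm (resolvent T z)
                 | z in [set z : R[i] | (1 < `|z|)%R]] < +oo)%E].

Definition is_adjoint S T : Prop := forall x y, inner (T x) y = inner x (S y).

Definition normal_op (T : {linear H -> H}) : Prop :=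
  exists S : {linear H -> H},
    [/\ (opnorm S < +oo)%E, is_adjoint S T & S \o T =1 T \o S].

Definition peripheral_spectrum T : set R[i] :=
  spectrum T `&` [set z | `|z| = 1].

Definition power_displacement (N : set nat) T : \bar R :=
  ereal_sup [set opnorm (fun x => x - iter n T x) | n in N].

End operators.

Section complex_series.
Context {R : realType}.
Implicit Types (u v : nat -> R[i]) (a z w : R[i]).

Definition csummable u :=
  cvgn (series (fun n => complex.Re (u n))) /\
  cvgn (series (fun n => complex.Im (u n))).

(* The sum of a complex series, computed on real and imaginary parts *)
Definition csum u : R[i] :=
  limn (series (fun n => complex.Re (u n))) +i*
  limn (series (fun n => complex.Im (u n))).

Lemma csummableD u v : csummable u -> csummable v ->
  csummable (fun n => u n + v n).
Proof.
move=> [ru iu] [rv iv]; split.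
- rewrite (_ : (fun n => _) = (fun n => complex.Re (u n)) + (fun n => complex.Re (v n))).
    exact: is_cvg_seriesD.
  by apply/funext => n; rewrite fctE; case: (u n) (v n) => ? ? [].
- rewrite (_ : (fun n => _) = (fun n => complex.Im (u n)) + (fun n => complex.Im (v n))).
    exact: is_cvg_seriesD.
  by apply/funext => n; rewrite fctE; case: (u n) (v n) => ? ? [].
Qed.

Lemma csumD u v : csummable u -> csummable v ->
  csum (fun n => u n + v n) = csum u + csum v.
Proof.
move=> [ru iu] [rv iv]; rewrite /csum.
rewrite (_ : (fun n => complex.Re (u n + v n)) =
  (fun n => complex.Re (u n)) + (fun n => complex.Re (v n))); last first.
  by apply/funext => n; rewrite fctE; case: (u n) (v n) => ? ? [].
rewrite (_ : (fun n => complex.Im (u n + v n)) =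
  (fun n => complex.Im (u n)) + (fun n => complex.Im (v n))); last first.
  by apply/funext => n; rewrite fctE; case: (u n) (v n) => ? ? [].
by rewrite !lim_seriesD.
Qed.

Lemma csumZ a u : csummable u -> csum (fun n => a * u n) = a * csum u.
Proof.
move=> [ru iu]; rewrite /csum; case: a => a b.
rewrite (_ : (fun n => complex.Re (_ * u n)) =
  a *: (fun n => complex.Re (u n)) + (- b) *: (fun n => complex.Im (u n))); last first.
  by apply/funext => n; rewrite !fctE/=; case: (u n) => c d; rewrite /GRing.scale/= mulNr.
rewrite (_ : (fun n => complex.Im (_ * u n)) =
  a *: (fun n => complex.Im (u n)) + b *: (fun n => complex.Re (u n))); last first.
  by apply/funext => n; rewrite !fctE/=; case: (u n) => c d; rewrite /GRing.scale/=.
rewrite !lim_seriesD; try exact: is_cvg_seriesZ.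
by rewrite !lim_seriesZ// /GRing.scale/= mulNr.
Qed.

Lemma csum_conj u : csummable u ->
  csum (fun n => (u n)^*) = (csum u)^*.
Proof.
move=> [_ iu]; rewrite /csum [RHS]/=; congr (_ +i* _).
  by congr (limn (series _)); apply/funext => n; case: (u n).
rewrite -lim_seriesN//; congr (limn (series _)).
by apply/funext => n; rewrite fctE; case: (u n).
Qed.

Lemma conjCE z : Num.conj z = z^*.
Proof. by []. Qed.

Lemma rnorm_sqr z : rnorm z ^+ 2 = complex.Re z ^+ 2 + complex.Im z ^+ 2.
Proof. by case: z => a b; rewrite /rnorm/= sqr_sqrtr// addr_ge0// sqr_ge0. Qed.

Lemma csummable_mulJ u v :
  cvgn (series (fun n => rnorm (u n) ^+ 2)) ->
  cvgn (series (fun n => rnorm (v n) ^+ 2)) ->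
  csummable (fun n => u n * (v n)^*).
Proof.
move=> cu cv.
have cuv : cvgn (series ((fun n => rnorm (u n) ^+ 2) + (fun n => rnorm (v n) ^+ 2))).
  exact: is_cvg_seriesD.
have cuv0 n : 0 <= ((fun n => rnorm (u n) ^+ 2) + (fun n => rnorm (v n) ^+ 2)) n.
  by rewrite fctE addr_ge0// sqr_ge0.
split; apply: normed_cvg; apply: (series_le_cvg _ cuv0 _ cuv) => n //=;
  rewrite fctE !rnorm_sqr;
  case: (u n) (v n) => a b [c d]; rewrite /= ler_norml;
  have := (sqr_ge0 (a - c), sqr_ge0 (a + c), sqr_ge0 (b - d), sqr_ge0 (b + d),
           sqr_ge0 (a - d), sqr_ge0 (a + d), sqr_ge0 (b - c), sqr_ge0 (b + c));
  have := (sqr_ge0 a, sqr_ge0 b, sqr_ge0 c, sqr_ge0 d);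
  move=> [[[? ?] ?] ?] [[[[[[[? ?] ?] ?] ?] ?] ?] ?]; apply/andP; split; nra.
Qed.

End complex_series.

Section ell2_def.
Context {R : realType}.

Definition square_summable (x : nat -> R[i]) : Prop :=
  cvgn (series (fun n => rnorm (x n) ^+ 2)).

Definition ell2_pred : {pred nat -> R[i]} := fun x => `[< square_summable x >].

Lemma ell2_predP x : reflect (square_summable x) (x \in ell2_pred).
Proof. exact: asboolP. Qed.

Lemma ell2_submod : submod_closed ell2_pred.
Proof.
split=> [|a x y /ell2_predP cx /ell2_predP cy]; apply/ell2_predP.
  rewrite /square_summable (_ : (fun n => _) = (fun=> 0)).
    rewrite (_ : series _ = fun=> 0); first exact: is_cvg_cst.
    by apply/funext => n; rewrite /series/= big1.
  by apply/funext => n; rewrite rnorm_sqr/= expr0n/= addr0.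
have cxy := is_cvg_seriesD (is_cvg_seriesZ (k := 2 * rnorm a ^+ 2) cx)
  (is_cvg_seriesZ (k := 2) cy).
apply: series_le_cvg cxy => n; rewrite ?sqr_ge0// !fctE /GRing.scale/=.
  by apply: addr_ge0; apply: mulr_ge0; rewrite ?sqr_ge0//; apply: mulr_ge0; rewrite ?sqr_ge0.
rewrite !rnorm_sqr; case: a (x n) (y n) => a b [c d] [e f] /=.
rewrite -subr_ge0 [leRHS](_ : _ = (a * c - b * d - e) ^+ 2 +
  (a * d + b * c - f) ^+ 2); first by rewrite addr_ge0 ?sqr_ge0.
ring.
Qed.

HB.instance Definition _ := GRing.isSubmodClosed.Build R[i] (nat -> R[i]) ell2_pred ell2_submod.

End ell2_def.

Record ell2 (R : realType) := Ell2 {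
  ell2_val :> nat -> R[i] ;
  _ : ell2_val \in ell2_pred }.

HB.instance Definition _ (R : realType) := [isSub for @ell2_val R].
HB.instance Definition _ (R : realType) := [Choice of ell2 R by <:].
HB.instance Definition _ (R : realType) :=
  [SubChoice_isSubLmodule of ell2 R by <:].

Section ell2_inner.
Context {R : realType}.
Implicit Types (x y : ell2 R) (a : R[i]).

Definition ell2_inner x y : R[i] := csum (fun n => x n * (y n)^*).

Lemma ell2P x : square_summable x.
Proof. by apply/ell2_predP; case: x. Qed.

Let ell2_csummable x y : csummable (fun n => x n * (y n)^*).
Proof. by apply: csummable_mulJ; exact: ell2P. Qed.

Lemma ell2_inner_hermitian x y : ell2_inner x y = Num.conj (ell2_inner y x).
Proof.
rewrite conjCE -csum_conj//; congr csum; apply/funext => n.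
by rewrite rmorphM/= conjcK mulrC.
Qed.

Lemma ell2_inner_linearl y a : {morph ell2_inner^~ y : x x' / a *: x + x' >-> a * x + x'}.
Proof.
move=> x x'; rewrite /ell2_inner -csumZ// -csumD//.
  by congr csum; apply/funext => n; rewrite mulrDl mulrA.
have [z ->] : exists z : ell2 R, (fun n => a * (x n * (y n)^*)) = fun n => z n * (y n)^*.
  by exists (a *: x); apply/funext => n; rewrite mulrA.
exact: ell2_csummable.
Qed.

Lemma ell2_inner_linearr x a :
  {morph ell2_inner x : y y' / a *: y + y' >-> Num.conj a * y + y'}.
Proof.
move=> y y'; rewrite !(ell2_inner_hermitian x) ell2_inner_linearl.
by rewrite rmorphD rmorphM.
Qed.

Lemma ell2_innerxx x :
  ell2_inner x x = (limn (series (fun n => rnorm (x n) ^+ 2)))%:C.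
Proof.
rewrite /ell2_inner /csum; congr (_ +i* _).
  congr (limn (series _)); apply/funext => n; rewrite rnorm_sqr.
  by case: (x n) => a b /=; rewrite mulrN opprK.
rewrite (_ : series _ = fun=> 0) ?lim_cst//.
apply/funext => n; rewrite /series/= big1// => i _.
by case: (x i) => a b /=; rewrite mulrN mulrC addrC subrr.
Qed.

Lemma ell2_sum_le x N :
  \sum_(0 <= n < N) rnorm (x n) ^+ 2 <= limn (series (fun n => rnorm (x n) ^+ 2)).
Proof.
have nd : nondecreasing_seq (series (fun n => rnorm (x n) ^+ 2)).
  by apply: nondecreasing_series => n _ _; exact: sqr_ge0.
exact: (nondecreasing_cvgn_le nd (@ell2P x) N).
Qed.

Lemma ell2_sum_ge0 x : 0 <= limn (series (fun n => rnorm (x n) ^+ 2)).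
Proof. by have := ell2_sum_le x 0; rewrite big_nil. Qed.

Lemma ell2_inner_gt0 x : x != 0 -> 0 < ell2_inner x x.
Proof.
move=> x0; rewrite ell2_innerxx ltcR lt_neqAle ell2_sum_ge0 andbT.
apply: contra x0 => /eqP s0; apply/eqP/val_inj/funext => n /=.
have := ell2_sum_le x n.+1; rewrite -s0 big_nat_recr//=.
have s1 : 0 <= \sum_(0 <= i < n) rnorm (x i) ^+ 2.
  by apply: sumr_ge0 => i _; exact: sqr_ge0.
rewrite rnorm_sqr; case: (x n) => a b /= ab; congr (_ +i* _); nra.
Qed.

HB.instance Definition _ := bilinear_isBilinear.Build R[i] (ell2 R) (ell2 R) R[i]
  *%R (Num.conj \; *%R) ell2_inner
  ((fun y => ell2_inner_linearl y), (fun x => ell2_inner_linearr x)).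
HB.instance Definition _ := isHermitianSesquilinear.Build R[i] (ell2 R) false
  Num.conj ell2_inner (fun x y => etrans (ell2_inner_hermitian x y) (esym (mul1r _))).
HB.instance Definition _ := isDotProduct.Build R[i] (ell2 R) ell2_inner ell2_inner_gt0.


End ell2_inner.

Lemma dot_CauchySchwarz (C : numClosedFieldType) (U : lmodType C)
    (f : {dot U for (@Num.conj C)}) (u v : U) :
  `|f u v| ^+ 2 <= f u u * f v v.
Proof.
have [->|v0] := eqVneq v 0; first by rewrite !linear0r normr0 expr0n/= lexx.
have fv : 0 < f v v by exact: neq0_dnorm_gt0.
have fvJ : Num.conj (f v v) = f v v by rewrite geC0_conj// ltW.
have fuvJ : f v u = Num.conj (f u v) by rewrite hermC/= expr0 mul1r.
have := dnorm_ge0 f (f v v *: u - f u v *: v).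
rewrite dnormB !dnormZ linearZr_LR/= !linearZl_LR/= !rmorphM/= fvJ conjCK.
rewrite (ger0_norm (ltW fv)) /GRing.scale/= (mulrA `|f u v|) -expr2 !normCK.
set c := Num.conj _; set p := f u u; set q := f v v; set r := f u v.
rewrite [leRHS](_ : _ = q * (p * q - r * c)); last by ring.
by rewrite pmulr_rge0// subr_ge0.
Qed.

Section ell2_norm.
Context {R : realType}.
Implicit Types (x y : ell2 R) (a : R[i]).

Definition ell2_norm x : R[i] :=
  (Num.sqrt (limn (series (fun n => rnorm (x n) ^+ 2))))%:C.

Lemma ell2_norm_sqr x : ell2_norm x ^+ 2 = ell2_inner x x.
Proof.
by rewrite ell2_innerxx /ell2_norm -rmorphXn/= sqr_sqrtr// ell2_sum_ge0.
Qed.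

Lemma ell2_norm_ge0 x : 0 <= ell2_norm x.
Proof. by rewrite /ell2_norm ler0c sqrtr_ge0. Qed.

Lemma ell2_normD x y : ell2_norm (x + y) <= ell2_norm x + ell2_norm y.
Proof.
have nn z : ell2_norm z \is Num.nneg by rewrite nnegrE ell2_norm_ge0.
rewrite -ler_sqr ?nnegrE ?addr_ge0 ?ell2_norm_ge0//.
rewrite sqrrD !ell2_norm_sqr (dnormD (ell2_inner : {dot _ for _})).
rewrite addrAC lerD2r lerD2l.
have CS : `|ell2_inner x y| <= ell2_norm x * ell2_norm y.
  rewrite -ler_sqr ?nnegrE ?mulr_ge0 ?ell2_norm_ge0//.
  by rewrite exprMn !ell2_norm_sqr; exact: dot_CauchySchwarz.
set d := (X in X + Num.conj X <= _) in CS *.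
have dr : d + Num.conj d \is Num.real.
  by apply/CrealP; rewrite rmorphD/= conjCK addrC.
rewrite (le_trans (real_ler_norm dr))// (le_trans (ler_normD _ _))//.
by rewrite norm_conjC -mulr2n lerMn2r CS orbT.
Qed.

Lemma ell2_normZ a x : ell2_norm (a *: x) = `|a| * ell2_norm x.
Proof.
apply: (pexpIrn (n := 2)); rewrite ?nnegrE ?mulr_ge0 ?ell2_norm_ge0//.
by rewrite exprMn !ell2_norm_sqr (dnormZ (ell2_inner : {dot _ for _})).
Qed.

Lemma ell2_norm_eq0 x : ell2_norm x = 0 -> x = 0.
Proof.
move=> x0; apply/eqP; rewrite -(dnorm_eq0 (ell2_inner : {dot _ for _})).
by rewrite /= -ell2_norm_sqr x0 expr0n.
Qed.

HB.instance Definition _ := Lmodule_isNormed.Build R[i] (ell2 R)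
  ell2_normD ell2_normZ ell2_norm_eq0.

Lemma ell2_normE x : `|x| = ell2_norm x.
Proof. by []. Qed.

End ell2_norm.

Section ell2_complete.
Context {R : realType}.
Implicit Types (x y : ell2 R) (F : set_system (ell2 R)).

Let ell2_rnormE x :
  rnorm x ^+ 2 = limn (series (fun n => rnorm (x n) ^+ 2)).
Proof. by rewrite /rnorm ell2_normE/= sqr_sqrtr// ell2_sum_ge0. Qed.

Let ell2_sum x N : \sum_(0 <= n < N) rnorm (x n) ^+ 2 <= rnorm x ^+ 2.
Proof. by rewrite ell2_rnormE ell2_sum_le. Qed.

Let ell2_le x (e : R) : 0 <= e ->
  (forall N, \sum_(0 <= n < N) rnorm (x n) ^+ 2 <= e ^+ 2) -> rnorm x <= e.
Proof.
move=> e0 xe; have x0 : 0 <= rnorm x.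
  by have := normr_ge0 x; rewrite /rnorm lecE => /andP[].
rewrite -ler_sqr ?nnegrE// ell2_rnormE.
have cx : cvgn (series (fun n => rnorm (x n) ^+ 2)) := @ell2P R x.
by apply: (limr_le cx); apply: nearW => N; exact: xe.
Qed.

Let rnorm_ge0 (V : normedModType R[i]) (v : V) : 0 <= rnorm v.
Proof. by have := normr_ge0 v; rewrite /rnorm lecE => /andP[]. Qed.

Let rnormE (V : normedModType R[i]) (v : V) : `|v| = (rnorm v)%:C.
Proof.
have := normr_ge0 v; rewrite /rnorm lecE => /andP[/eqP/= + _].
by case: `|v| => a b /= ->.
Qed.

Let ell2_ball x y (e : R) : ball x e%:C y -> rnorm (x - y) < e.
Proof. by rewrite -ball_normE/= rnormE ltcR. Qed.

Let ell2_coord x n : rnorm (x n) <= rnorm x.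
Proof.
rewrite -ler_sqr ?nnegrE ?rnorm_ge0//; last by have := rnorm_ge0 (x n : R[i]^o).
have := ell2_sum x n.+1; rewrite big_nat_recr//=; apply: le_trans.
by rewrite lerDr sumr_ge0// => i _; exact: sqr_ge0.
Qed.

Let Re_le (z : R[i]) : `|complex.Re z| <= rnorm z.
Proof.
have z0 : 0 <= rnorm z by have := rnorm_ge0 (z : R[i]^o).
by rewrite -ler_sqr ?nnegrE// real_normK ?num_real// rnorm_sqr lerDl sqr_ge0.
Qed.

Let Im_le (z : R[i]) : `|complex.Im z| <= rnorm z.
Proof.
have z0 : 0 <= rnorm z by have := rnorm_ge0 (z : R[i]^o).
by rewrite -ler_sqr ?nnegrE// real_normK ?num_real// rnorm_sqr lerDr sqr_ge0.
Qed.

Let cauchy_ex F : ProperFilter F -> cauchy F ->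
  forall e : R, 0 < e -> exists x, F (ball x e%:C).
Proof.
by move=> FF /cauchyP cF e e0; apply: cF; rewrite ltcR.
Qed.

Let cvg_Re F n : ProperFilter F -> cauchy F ->
  cvg ((fun x : ell2 R => complex.Re (x n)) @ F).
Proof.
move=> FF cF; apply/cauchy_cvgP/cauchy_exP => e e0.
have [x Fx] := cauchy_ex FF cF e0.
exists (complex.Re (x n)).
suff : F [set y : ell2 R | ball (complex.Re (x n)) e (complex.Re (y n))] by [].
apply: filterS Fx => y /= /ell2_ball xye.
rewrite -ball_normE/=; apply: (le_lt_trans _ xye).
apply: (le_trans _ (ell2_coord (x - y) n)); apply: (le_trans _ (Re_le _)).
by rewrite (_ : (x - y) n = x n - y n)//; case: (x n) (y n) => ? ? [].
Qed.

Let cvg_Im F n : ProperFilter F -> cauchy F ->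
  cvg ((fun x : ell2 R => complex.Im (x n)) @ F).
Proof.
move=> FF cF; apply/cauchy_cvgP/cauchy_exP => e e0.
have [x Fx] := cauchy_ex FF cF e0.
exists (complex.Im (x n)).
suff : F [set y : ell2 R | ball (complex.Im (x n)) e (complex.Im (y n))] by [].
apply: filterS Fx => y /= /ell2_ball xye.
rewrite -ball_normE/=; apply: (le_lt_trans _ xye).
apply: (le_trans _ (ell2_coord (x - y) n)); apply: (le_trans _ (Im_le _)).
by rewrite (_ : (x - y) n = x n - y n)//; case: (x n) (y n) => ? ? [].
Qed.

Let ell2_complete F : ProperFilter F -> cauchy F -> cvg F.
Proof.
move=> FF cF.
pose l n : R[i] := lim ((fun x : ell2 R => complex.Re (x n)) @ F) +i*
                   lim ((fun x : ell2 R => complex.Im (x n)) @ F).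
have lP x e N : F (ball x e%:C) ->
    \sum_(0 <= n < N) rnorm (x n - l n) ^+ 2 <= e ^+ 2.
  move=> Fx.
  have cs : (fun y : ell2 R => \sum_(0 <= n < N) rnorm (x n - y n) ^+ 2) y @[y --> F]
      --> \sum_(0 <= n < N) rnorm (x n - l n) ^+ 2.
    apply: cvg_big => [|n _]; [exact: add_continuous|rewrite rnorm_sqr].
    rewrite (_ : (fun y : ell2 R => _) = fun y : ell2 R =>
      (complex.Re (x n) - complex.Re (y n)) ^+ 2 +
      (complex.Im (x n) - complex.Im (y n)) ^+ 2); last first.
      by apply/funext => y; rewrite rnorm_sqr; case: (x n) (y n) => ? ? [].
    rewrite (_ : complex.Re (x n - l n) = complex.Re (x n) - complex.Re (l n)); last first.
      by case: (x n) (l n) => ? ? [].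
    rewrite (_ : complex.Im (x n - l n) = complex.Im (x n) - complex.Im (l n)); last first.
      by case: (x n) (l n) => ? ? [].
    have sq (f : ell2 R -> R) (a c : R) : f @ F --> c ->
        (fun y => (a - f y) ^+ 2) @ F --> (a - c) ^+ 2.
      move=> fc; have ac : (fun y => a - f y) @ F --> a - c.
        by apply: cvgB => //; exact: cvg_cst.
      exact: (cvgM ac ac).
    by apply: cvgD; apply: sq; [exact: cvg_Re|exact: cvg_Im].
  rewrite -(cvg_lim _ cs)//; apply: limr_le; first by apply/cvg_ex; eexists; exact: cs.
  apply: filterS Fx => y /ell2_ball xye.
  apply: (le_trans (ell2_sum (x - y) N)).
  by rewrite ler_sqr ?nnegrE ?rnorm_ge0// ltW// (le_lt_trans _ xye)// rnorm_ge0.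
have [x0 Fx0] := cauchy_ex FF cF ltr01.
have sd : (fun n => x0 n - l n) \in ell2_pred.
  apply/ell2_predP; apply: nondecreasing_is_cvgn.
    by apply: nondecreasing_series => n _ _; exact: sqr_ge0.
  by exists (1 ^+ 2) => _ [N _ <-]; exact: lP.
pose z := x0 - Ell2 sd.
have zl n : z n = l n by rewrite -[z n]/(x0 n - (x0 n - l n)) opprB addrC subrK.
clearbody z.
have xz x (e : R) : 0 < e -> F (ball x e%:C) -> rnorm (x - z) <= e.
  move=> e0 Fx; apply: ell2_le => [|N]; first exact: ltW.
  rewrite (eq_bigr (fun n => rnorm (x n - l n) ^+ 2)); first exact: lP.
  by move=> n _; rewrite -zl.
apply/cvg_ex; exists z; apply/cvgrPdist_lt => e e0.
have [r r0 ->] : exists2 r : R, 0 < r & e = r%:C.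
  move: e0; case: e => a b; rewrite ltcE/= => /andP[/eqP -> a0].
  by exists a.
have r20 : 0 < r / 2 by rewrite divr_gt0.
have [x Fx] := cauchy_ex FF cF r20.
apply: filterS (Fx) => y /ell2_ball xy.
rewrite rnormE ltcR -ltcR -rnormE -(subrKA x) (le_lt_trans (ler_normD _ _))//.
rewrite distrC !rnormE -rmorphD ltcR (splitr r) ler_ltD//.
exact: xz.
Qed.

HB.instance Definition _ := Uniform_isComplete.Build (ell2 R) ell2_complete.

End ell2_complete.

HB.instance Definition _ (R : realType) :=
  CompleteNormedModule_isHilbert.Build R (ell2 R) (@ell2_norm_sqr R).

Section ell2_diagonal.
Context {R : realType}.

Lemma ell2_basis_subproof j :
  (fun n => (n == j)%:R : R[i]) \in @ell2_pred R.
Proof.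
apply/ell2_predP; apply: nondecreasing_is_cvgn.
  by apply: nondecreasing_series => n _ _; exact: sqr_ge0.
exists 1 => _ [N _ <-]; rewrite /series/=.
suff -> : \sum_(0 <= n < N) rnorm ((n == j)%:R : R[i]) ^+ 2 = (j < N)%:R :> R.
  by case: (j < N)%N.
elim: N => [|N IH]; first by rewrite big_nil.
rewrite big_nat_recr//= IH rnorm_sqr ltnS.
by case: (ltngtP j N) => jN /=; rewrite ?expr1n ?expr0n /= ?addr0 ?add0r.
Qed.

Definition ell2_basis j : ell2 R := Ell2 (ell2_basis_subproof j).

Definition diagonal_contraction (T : {linear ell2 R -> ell2 R}) : Prop :=
  (opnorm T < +oo)%E /\
  exists z : nat -> R[i],
    (forall j, `|z j| <= 1) /\
    (forall j, T (ell2_basis j) = z j *: ell2_basis j).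

End ell2_diagonal.

(* mathcomp's ln vanishes on nonpositive arguments, but the second branch only
   applies it to positive ones *)
Definition kappa {R : realType} (N : set nat) (t : R) : \bar R :=
  if `[< exists2 n, N n & cos (n%:R * t) <= 0 >] then +oo%E
  else ereal_sup [set (Num.max (- ln (2 * cos (n%:R * t))) 0 / n%:R)%:E
                 | n in N].

(* Main.v *)
Require Import Defs.
From HB Require Import structures.
From mathcomp Require Import all_boot all_order all_algebra.
From mathcomp Require Import complex ring lra.
From mathcomp Require Import all_classical all_reals all_analysis.

Set Implicit Arguments.
Unset Strict Implicit.
Unset Printing Implicit Defensive.

Import Order.TTheory GRing.Theory Num.Theory.
Import numFieldNormedType.Exports.

Local Open Scope classical_set_scope.
Local Open Scope ring_scope.
Local Open Scope complex_scope.

(** For a normal operator everything is decided by the spectrum: the resolvent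
    norm is the inverse of the distance to the spectrum, so a normal contraction
    is Ritt as soon as its spectrum lies in a Stolz domain
    [|1 - z| <= K (1 - |z|)].  The condition [|1 - z^n| <= 1] for [z = r e^(it)]
    reads [r^n <= 2 cos (n t)]; hence all displacements with exponents in [N] are
    at most [1] exactly when [- ln r >= kappa t] ([kappa_le_displacement]).  The
    admissible points therefore fill a region whose boundary is the curve
    [1 - r ~ kappa t], and this region is contained in a Stolz domain at [1]
    exactly when [kappa] grows at least linearly at [0].

    If it does, [stolz_of_kappa] confines the spectrum to a Stolz domain, and
    [normal_contraction_ritt] concludes.  If it does not, points of that region
    approach [1] tangentially, and a diagonal operator with these eigenvalues is
    not Ritt ([exists_non_ritt_diagonal]).  A diagonal contraction is a normal
    contraction ([diagonal_contraction_normal]), which closes the circle.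

    The spectral theorem is avoided as follows.  The spectrum of a normal
    operator consists of approximate eigenvalues, because a normal operator that
    is bounded below is onto ([normal_bounded_below_onto]); this yields the
    spectral mapping property directly.  For the resolvent norm one has to find
    an approximate eigenvalue of modulus [|S|] of the resolvent [S].  Normality
    gives [|S x|^2 <= |S^2 x| |x|], and from this inequality the averaging over
    roots of unity in [paranormal_spectral_radius] produces the approximate
    eigenvalue. *)

(** * Real-valued norms and operator norms *)

Section rnorm_theory.
Context {R : realType} {V : normedZmodType R[i]}.
Implicit Types (x y : V) (a : R[i]).

Lemma rnormE x : `|x| = (rnorm x)%:C.
Proof.
have := normr_ge0 x; rewrite /rnorm lecE => /andP[/eqP/= + _].
by case: `|x| => a b /= ->.
Qed.

Lemma rnorm_ge0 x : 0 <= rnorm x.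
Proof. by have := normr_ge0 x; rewrite /rnorm lecE => /andP[]. Qed.

Lemma rnorm_le1 x : (`|x| <= 1) = (rnorm x <= 1).
Proof. by rewrite rnormE -lecR. Qed.

Lemma rnorm0 : rnorm (0 : V) = 0.
Proof. by rewrite /rnorm normr0. Qed.

Lemma rnorm_eq0 x : (rnorm x == 0) = (x == 0).
Proof.
rewrite -(normr_eq0 x) rnormE; apply/eqP/eqP => [->//|].
by move=> /(congr1 (@complex.Re R)).
Qed.

Lemma rnorm_gt0 x : (0 < rnorm x) = (x != 0).
Proof. by rewrite lt_neqAle eq_sym rnorm_eq0 rnorm_ge0 andbT. Qed.

Lemma rnormN x : rnorm (- x) = rnorm x.
Proof. by rewrite /rnorm normrN. Qed.

Lemma rnormD x y : rnorm (x + y) <= rnorm x + rnorm y.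
Proof. by have := ler_normD x y; rewrite !rnormE -rmorphD/= lecR. Qed.

Lemma rnormB x y : rnorm (x - y) <= rnorm x + rnorm y.
Proof. by rewrite -(rnormN y) rnormD. Qed.

Lemma rnorm_distC x y : rnorm (x - y) = rnorm (y - x).
Proof. by rewrite -rnormN opprB. Qed.

Lemma rnormBB x y : rnorm x - rnorm y <= rnorm (x - y).
Proof. by rewrite lerBlDr -{1}(subrK y x) rnormD. Qed.

End rnorm_theory.

Section rnorm_complex.
Context {R : realType}.
Implicit Types (a b z : R[i]) (r : R).

Lemma crnormM a b : rnorm (a * b) = rnorm a * rnorm b.
Proof.
by have := normrM a b; rewrite !rnormE -rmorphM/= => /(congr1 (@complex.Re R)).
Qed.

Lemma crnormX a n : rnorm (a ^+ n) = rnorm a ^+ n.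
Proof.
elim: n => [|n IH]; last by rewrite !exprS crnormM IH.
by rewrite !expr0 /rnorm normr1.
Qed.

Lemma crnorm_real r : rnorm r%:C = `|r|.
Proof. by rewrite /rnorm normc_def/= expr0n addr0 sqrtr_sqr. Qed.

Lemma crnorm1 : rnorm (1 : R[i]) = 1.
Proof. by rewrite /rnorm normr1. Qed.

Lemma crnorm_norm1 z : `|z| = 1 <-> rnorm z = 1.
Proof.
rewrite rnormE; split=> [/(congr1 (@complex.Re R))//|->//].
Qed.

Lemma crnorm_gt1 z : (1 < `|z|) = (1 < rnorm z).
Proof. by rewrite rnormE -ltcR. Qed.

Lemma crnormV z : rnorm z^-1 = (rnorm z)^-1.
Proof.
have [->|z0] := eqVneq z 0; first by rewrite invr0 /rnorm normr0 invr0.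
have n0 : rnorm z != 0 by rewrite rnorm_eq0.
by apply: (mulfI n0); rewrite -crnormM !divff// crnorm1.
Qed.

Lemma crnormJ z : rnorm (Num.conj z) = rnorm z.
Proof. by rewrite /rnorm norm_conjC. Qed.

Lemma rnormZ (V : normedModType R[i]) a (x : V) :
  rnorm (a *: x) = rnorm a * rnorm x.
Proof.
by have := normrZ a x; rewrite !rnormE -rmorphM/= => /(congr1 (@complex.Re R)).
Qed.

End rnorm_complex.

Section opnorm_theory.
Context {R : realType} {H : hilbertType R}.
Implicit Types (f : H -> H) (M : R).

Lemma scalable0 f : scalable f -> f 0 = 0.
Proof. by move=> fZ; have := fZ 0 0; rewrite !scale0r. Qed.

Lemma linear_scalable f : linear f -> scalable f.
Proof.
move=> fl a x; have := fl (-1) 0 0; have := fl a x 0.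
by rewrite addr0 scaler0 addr0 scaleN1r addNr => -> ->; rewrite addr0.
Qed.

Lemma opnorm_leP f M : scalable f -> 0 <= M ->
  (opnorm f <= M%:E)%E <-> forall x, rnorm (f x) <= M * rnorm x.
Proof.
move=> fZ M0; split=> [fM x|fM]; last first.
  apply: ge_ereal_sup => _ [x /= x1 <-]; rewrite lee_fin (le_trans (fM x))//.
  by rewrite ler_piMr// -rnorm_le1.
have [->|x0] := eqVneq x 0; first by rewrite scalable0// rnorm0 mulr0.
have nx : 0 < rnorm x by rewrite rnorm_gt0.
have nVx : rnorm (rnorm x)^-1%:C = (rnorm x)^-1.
  by rewrite crnorm_real ger0_norm ?invr_ge0 ?rnorm_ge0.
have : rnorm (f ((rnorm x)^-1%:C *: x)) <= M.
  rewrite -lee_fin; apply: le_trans fM; apply: ereal_sup_ubound.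
  by exists ((rnorm x)^-1%:C *: x) => //=; rewrite rnorm_le1 rnormZ nVx mulVf// gt_eqF.
by rewrite fZ rnormZ nVx mulrC ler_pdivrMr.
Qed.

Lemma opnorm_ge0 f : scalable f -> (0 <= opnorm f)%E.
Proof.
move=> fZ; apply: ereal_sup_ubound; exists 0; rewrite /= ?normr0//.
by rewrite scalable0// rnorm0.
Qed.

Lemma opnorm_finP f : scalable f -> (opnorm f < +oo)%E ->
  exists2 M, 0 <= M & opnorm f = M%:E.
Proof.
move=> fZ foo; exists (fine (opnorm f)); first by rewrite fine_ge0 ?opnorm_ge0.
by rewrite fineK// ge0_fin_numE// opnorm_ge0.
Qed.

End opnorm_theory.

(** * Invertibility of normal operators bounded below *)

Section neumann.
Context {R : realType} {V : completeNormedModType R[i]}.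
Variables (P : {linear V -> V}) (q : R).
Hypotheses (q0 : 0 <= q) (q1 : q < 1) (Pq : forall x, rnorm (P x) <= q * rnorm x).

Let iterPq k w : rnorm (iter k P w) <= q ^+ k * rnorm w.
Proof.
elim: k => [|k IH]; first by rewrite expr0 mul1r.
by rewrite iterS exprS -mulrA (le_trans (Pq _))// ler_wpM2l.
Qed.

(* Partial sums of the Neumann series at w. *)
Let y w n := \sum_(k < n) iter k P w.

Let y_dist w n m : (1 - q) * rnorm (y w n - y w (n + m)) <= q ^+ n * rnorm w.
Proof.
have : (1 - q) * rnorm (y w n - y w (n + m)) <= (q ^+ n - q ^+ (n + m)) * rnorm w.
  elim: m => [|m IH]; first by rewrite addn0 !subrr rnorm0 mulr0 mul0r.
  rewrite addnS {2}/y big_ord_recr/= -/(y w (n + m)) opprD addrA.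
  rewrite (le_trans (ler_wpM2l _ (rnormB _ _)))//; first by rewrite subr_ge0 ltW.
  rewrite mulrDr.
  have := ler_wpM2l (_ : 0 <= 1 - q) (iterPq (n + m) w).
  rewrite subr_ge0 ltW// => /(_ isT); rewrite exprS. lra.
move=> /le_trans; apply; rewrite ler_wpM2r ?rnorm_ge0// gerBl exprn_ge0//.
Qed.

(** The partial sums of the Neumann series of [P] at [w] are Cauchy by the
    geometric bound [y_dist], and their limit solves the equation. *)
Lemma neumann_solvable w : exists x, x - P x = w.
Proof.
have q10 : 0 < 1 - q by rewrite subr_gt0.
have geo (e : R) : 0 < e -> exists n, q ^+ n * rnorm w < e.
  move=> e0; have : (fun n => q ^+ n * rnorm w) @ \oo --> (0 : R).
    rewrite -(mul0r (rnorm w)); apply: cvgM; last exact: cvg_cst.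
    by apply: cvg_expr; rewrite ger0_norm.
  move=> /cvgrPdist_lt /(_ _ e0) [n _ /(_ n (leqnn n))]/=.
  rewrite sub0r normrN => /(le_lt_trans (ler_norm _)) ?; by exists n.
have yc : cvgn (y w).
  apply/cauchy_cvgP/cauchy_exP => e e0.
  have eE : e = (complex.Re e)%:C.
    by move: e0; case: e => a b; rewrite ltcE/= => /andP[/eqP -> _].
  have e0' : 0 < complex.Re e by rewrite -ltcR -eE.
  have [n qn] := geo ((1 - q) * complex.Re e) (mulr_gt0 q10 e0').
  exists (y w n); exists n => // m /= nm; rewrite -ball_normE/=.
  rewrite rnormE eE ltcR -(ltr_pM2l q10); apply: le_lt_trans qn.
  by rewrite -(subnKC nm); exact: y_dist.
have /cvg_ex[x yx] := yc.
exists x; apply/eqP; rewrite -subr_eq0 -rnorm_eq0 eq_le rnorm_ge0 andbT.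
apply/ler_addgt0Pr => e e0; rewrite add0r.
have e4 : 0 < e / 4 by rewrite divr_gt0.
have e4C : 0 < (e / 4)%:C :> R[i] by rewrite ltcR.
have [n qn] := geo _ e4.
move/cvgrPdist_lt : yx => /(_ _ e4C) [m _ xm].
have {xm} := xm (maxn n m) (leq_maxr n m).
set k := maxn n m; rewrite rnormE ltcR => xk.
have yk : y w k - P (y w k) = w - iter k P w.
  clear; elim: k => [|k IH]; first by rewrite /y !big_ord0 linear0 subrr /= subrr.
  rewrite /y big_ord_recr/= -/(y w k) linearD opprD addrACA IH.
  by rewrite addrA subrK.
have -> : x - P x - w = (x - y w k) - P (x - y w k) - iter k P w.
  have -> : iter k P w = w - (y w k - P (y w k)) by rewrite yk opprB addrC subrK.
  rewrite linearB opprB opprB (addrC (P _)) (addrACA x) (addrC (- y w k)).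
  by rewrite -(opprB (y w k)) subrKA.
have := rnormB ((x - y w k) - P (x - y w k)) (iter k P w).
have := rnormB (x - y w k) (P (x - y w k)).
have := Pq (x - y w k); have := iterPq k w.
have : q ^+ k * rnorm w <= q ^+ n * rnorm w.
  by rewrite ler_wpM2r ?rnorm_ge0// ler_wiXn2l// ?ltW// leq_maxl.
have := rnorm_ge0 (x - y w k).
have : q * rnorm (x - y w k) <= rnorm (x - y w k) by rewrite ler_piMl ?rnorm_ge0// ltW.
lra.
Qed.

End neumann.

Section normal_operators.
Context {R : realType} {H : hilbertType R}.
Implicit Types (x y : H) (A S T : {linear H -> H}).

Lemma inner_conj x y : inner x y = Num.conj (inner y x).
Proof. by rewrite hermC/= expr0 mul1r. Qed.

Lemma rnorm_inner x : inner x x = (rnorm x ^+ 2)%:C.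
Proof. by rewrite -norm_inner rnormE rmorphXn. Qed.

Lemma cauchy_schwarz x y : rnorm (inner x y) <= rnorm x * rnorm y.
Proof.
rewrite -(@ler_pXn2r _ 2%N)// ?nnegrE ?mulr_ge0 ?rnorm_ge0//.
have := dot_CauchySchwarz (@inner R H) x y.
by rewrite !rnorm_inner rnormE -rmorphXn/= -rmorphM/= lecR exprMn.
Qed.

Lemma rnorm_sqr_subZ x y (t : R) :
  rnorm (x - t%:C *: y) ^+ 2 =
  rnorm x ^+ 2 - 2 * t * complex.Re (inner x y) + t ^+ 2 * rnorm y ^+ 2.
Proof.
have := rnorm_inner (x - t%:C *: y); rewrite dnormB dnormZ linearZr_LR/=.
rewrite !rnorm_inner rnormE crnorm_real => /(congr1 (@complex.Re R)).
case: (inner x y) => a b /=.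
have -> : `|t| * `|t| = t ^+ 2 by rewrite -expr2 real_normK ?num_real.
by move=> <-; ring.
Qed.

Lemma normal_rnorm A S x : is_adjoint S A -> S \o A =1 A \o S ->
  rnorm (S x) = rnorm (A x).
Proof.
move=> adj com; apply: (@pexpIrn _ 2%N); rewrite ?nnegrE ?rnorm_ge0//.
suff : inner (S x) (S x) = inner (A x) (A x).
  by rewrite !rnorm_inner => /(congr1 (@complex.Re R)).
rewrite -adj; have /= <- := com x.
by rewrite inner_conj -adj -inner_conj.
Qed.

(** Cauchy-Schwarz for [|A x|^2 = <A* A x, x>], followed by
    [|A* y| = |A y|] at [y = A x]. *)
Lemma normal_paranormal A S x : is_adjoint S A -> S \o A =1 A \o S ->
  rnorm (A x) ^+ 2 <= rnorm (A (A x)) * rnorm x.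
Proof.
move=> adj com; rewrite -(normal_rnorm (A x) adj com) mulrC.
have := cauchy_schwarz x (S (A x)).
by rewrite -adj rnorm_inner crnorm_real ger0_norm// sqr_ge0.
Qed.

(** The operator [A* A = A A*] is coercive, so for a small step [t] the map
    [x - t A* A x] is a strict contraction; the Neumann series then solves
    [t A* A x = t w], and [A* x] is a preimage of [w] under [A].  This
    avoids orthogonal complements of closed ranges. *)
Lemma normal_bounded_below_onto A S (c M : R) :
  is_adjoint S A -> S \o A =1 A \o S -> 0 < c ->
  (forall x, c * rnorm x <= rnorm (A x)) ->
  (forall x, rnorm (A x) <= M * rnorm x) -> forall w, exists x, A x = w.
Proof.
move=> adj com c0 Ac AM w.
pose K := Num.max M c.
have K0 : 0 < K by rewrite lt_max c0 orbT.
have K0' := ltW K0.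
have cK : c <= K by rewrite le_max lexx orbT.
have {}AM x : rnorm (A x) <= K * rnorm x.
  by rewrite (le_trans (AM x))// ler_wpM2r ?rnorm_ge0// le_max lexx.
(* The minimizer of 1 - 2 t c ^ 2 + t ^ 2 K ^ 4, with minimum 1 - u. *)
pose t := c ^+ 2 / K ^+ 4.
have t0 : 0 < t by rewrite divr_gt0 ?exprn_gt0.
pose P0 x := x - t%:C *: S (A x).
have Plin : linear P0.
  by move=> a x y; rewrite /P0 (linearP A) (linearP S) /= scalerDr opprD addrACA
    scalerBr !scalerA mulrC.
pose P : {linear H -> H} := HB.pack P0 (GRing.isLinear.Build _ _ _ _ P0 Plin).
pose u := c ^+ 4 / K ^+ 4.
have u0 : 0 < u by rewrite divr_gt0 ?exprn_gt0.
have u1 : u <= 1.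
  by rewrite ler_pdivrMr ?exprn_gt0// mul1r lerXn2r// nnegrE ltW.
have Pq x : rnorm (P x) <= (1 - u / 2) * rnorm x.
  (* 1 - u <= (1 - u / 2) ^ 2, which avoids a square root. *)
  have h0 : 0 <= 1 - u / 2 by lra.
  rewrite -(@ler_pXn2r _ 2%N)// ?nnegrE ?mulr_ge0 ?rnorm_ge0//.
  have -> : rnorm (P x) ^+ 2 = rnorm x ^+ 2 - 2 * t * rnorm (A x) ^+ 2 +
      t ^+ 2 * rnorm (S (A x)) ^+ 2.
    rewrite /P/= /P0 rnorm_sqr_subZ -adj rnorm_inner/=; ring.
  rewrite (normal_rnorm _ adj com).
  have h1 : rnorm (A (A x)) ^+ 2 <= K ^+ 4 * rnorm x ^+ 2.
    have -> : K ^+ 4 * rnorm x ^+ 2 = (K * (K * rnorm x)) ^+ 2 by ring.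
    rewrite lerXn2r ?nnegrE ?mulr_ge0 ?rnorm_ge0//.
    by rewrite (le_trans (AM _))// ler_wpM2l.
  have h2 : c ^+ 2 * rnorm x ^+ 2 <= rnorm (A x) ^+ 2.
    by rewrite -exprMn lerXn2r ?nnegrE ?mulr_ge0 ?rnorm_ge0// ltW.
  have h3 : t * (c ^+ 2 * rnorm x ^+ 2) <= t * rnorm (A x) ^+ 2 by rewrite ler_wpM2l// ltW.
  have h4 : t ^+ 2 * rnorm (A (A x)) ^+ 2 <= t ^+ 2 * (K ^+ 4 * rnorm x ^+ 2).
    by rewrite ler_wpM2l// sqr_ge0.
  have e1 : t * c ^+ 2 = u by rewrite /t /u; field; rewrite gt_eqF.
  have e2 : t ^+ 2 * K ^+ 4 = u by rewrite /t /u; field; rewrite gt_eqF.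
  rewrite (mulrA t) e1 in h3; rewrite (mulrA _ (K ^+ 4)) e2 in h4.
  clearbody t; clear P0 Plin P; clearbody u.
  have : 0 <= (u / 2 * rnorm x) ^+ 2 by rewrite sqr_ge0.
  nra.
have [||x Px] := @neumann_solvable R H P (1 - u / 2) _ _ Pq (t%:C *: w); [lra|lra|].
exists (S x).
have tC : t%:C != 0 :> R[i] by rewrite (inj_eq (@complexI R)) gt_eqF.
apply: (scalerI tC); rewrite -Px /P/= /P0 opprB addrCA subrr addr0.
by have /= -> := com x.
Qed.

End normal_operators.

(** * Approximate eigenvalues *)

Section approximate_spectrum.
Context {R : realType} {H : hilbertType R}.
Implicit Types (x y : H) (S T : {linear H -> H}) (z : R[i]) (c M : R).

(** The strict inequality forces [x] to be nonzero, so unit vectors need not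
    be mentioned and the zero space has no approximate eigenvalue. *)
Definition approx_eigenvalue (T : H -> H) z : Prop :=
  forall c, 0 < c -> exists x, rnorm (z *: x - T x) < c * rnorm x.

Definition bounded_below (T : H -> H) z c : Prop :=
  forall x, c * rnorm x <= rnorm (z *: x - T x).

Lemma bounded_belowP (T : H -> H) z :
  (exists2 c, 0 < c & bounded_below T z c) <-> ~ approx_eigenvalue T z.
Proof.
split=> [[c c0 Tc] /(_ c c0)[x]|]; first by rewrite ltNge Tc.
move=> /existsNP[c /not_implyP[c0 /forallNP Tc]]; exists c => // x.
by rewrite leNgt; apply/negP; exact: Tc.
Qed.

Lemma bounded_below_near (T : H -> H) z w c d :
  bounded_below T z c -> rnorm (w - z) <= d -> bounded_below T w (c - d).
Proof.
move=> Tc wz x; rewrite mulrBl lerBlDr (le_trans (Tc x))//.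
have -> : z *: x - T x = (w *: x - T x) - (w - z) *: x.
  by rewrite scalerBl opprB [RHS]addrC subrKA.
by rewrite (le_trans (rnormB _ _))// lerD2l rnormZ ler_wpM2r// rnorm_ge0.
Qed.

Lemma approx_eigenvalue_spectrum (T : H -> H) z :
  approx_eigenvalue T z -> spectrum T z.
Proof.
move=> Tz [S [Slin Sfin _ SK]].
have [M M0 SM] : exists2 M, 0 < M & forall x, rnorm (S x) <= M * rnorm x.
  have SZ := linear_scalable Slin.
  have [M M0 SM] := opnorm_finP SZ Sfin.
  exists (M + 1) => [|x]; first by rewrite ltr_wpDl.
  have /(opnorm_leP SZ M0) /(_ x) : (opnorm S <= M%:E)%E by rewrite SM.
  by move=> /le_trans; apply; rewrite ler_wpM2r ?rnorm_ge0// lerDl.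
have MV : 0 < M^-1 by rewrite invr_gt0.
have [x xS] := Tz _ MV; have := SM (z *: x - T x); rewrite SK leNgt => /negP; apply.
by rewrite -(ltr_pM2l M0) mulrA mulfV ?gt_eqF// mul1r in xS.
Qed.

Lemma normal_shift T z : normal_op T -> exists A B : {linear H -> H},
  [/\ forall x, A x = z *: x - T x, is_adjoint B A & B \o A =1 A \o B].
Proof.
move=> [S [_ adj com]].
have lin (L : {linear H -> H}) a : linear (fun x => a *: x - L x).
  move=> b x y; rewrite (linearP L)/= scalerDr opprD addrACA scalerBr.
  by rewrite !scalerA mulrC.
pose A : {linear H -> H} := HB.pack (fun x => z *: x - T x)
  (GRing.isLinear.Build _ _ _ _ (fun x => z *: x - T x) (lin T z)).
pose B : {linear H -> H} := HB.pack (fun x => Num.conj z *: x - S x)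
  (GRing.isLinear.Build _ _ _ _ (fun x => Num.conj z *: x - S x) (lin S (Num.conj z))).
exists A, B; split=> //.
  move=> x y; rewrite /= linearBl linearBr/= adj linearZl_LR linearZr_LR/=.
  by rewrite conjCK.
move=> x; rewrite /= (linearB S) (linearB T) (linearZ_LR S) (linearZ_LR T)/=.
have /= -> := com x; rewrite !scalerBr !scalerA (mulrC z) !opprB.
by rewrite addrACA [RHS]addrACA (addrC (- (z *: _))).
Qed.

(** A normal operator has no residual spectrum: bounded below, it is onto by
    [normal_bounded_below_onto], and its inverse is bounded. *)
Lemma spectrum_approx_eigenvalue T z : normal_op T -> (opnorm T < +oo)%E ->
  spectrum T z -> approx_eigenvalue T z.
Proof.
move=> /(@normal_shift _ z)[A [B [AE adj com]]] Tfin.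
apply: contraPP => /bounded_belowP[c c0 Tc] nTz.
have [M M0 TM] := opnorm_finP (linearZ_LR T) Tfin.
have /(opnorm_leP (linearZ_LR T) M0) {}TM : (opnorm T <= M%:E)%E by rewrite TM.
apply: nTz.
have {}Tc x : c * rnorm x <= rnorm (A x) by rewrite AE.
have AM x : rnorm (A x) <= (rnorm z + M) * rnorm x.
  by rewrite AE (le_trans (rnormB _ _))// rnormZ mulrDl lerD2l.
have onto := normal_bounded_below_onto adj com c0 Tc AM.
have inj x y : A x = A y -> x = y.
  move=> Axy; apply/eqP; rewrite -subr_eq0 -rnorm_eq0 eq_le rnorm_ge0 andbT.
  by have := Tc (x - y); rewrite linearB Axy subrr rnorm0 pmulr_rle0.
have [Q QK] := choice onto.
have Qlin : linear Q by move=> a x y; apply: inj; rewrite (linearP A) !QK.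
exists Q; split => //.
- apply: (@le_lt_trans _ _ (c^-1)%:E); last by rewrite ltry.
  apply/opnorm_leP; rewrite ?invr_ge0 ?ltW//; first exact: linear_scalable.
  move=> x; rewrite -(ler_pM2l c0) mulrA mulfV ?gt_eqF// mul1r.
  by rewrite (le_trans (Tc _))// QK.
- by move=> x; rewrite -AE QK.
- by move=> x; apply: inj; rewrite QK AE.
Qed.

Lemma approx_eigenvalue_pow T z n c : 0 < c -> approx_eigenvalue T z ->
  (forall x, rnorm (T x) <= rnorm x) -> rnorm z <= 1 ->
  exists2 x, 0 < rnorm x & rnorm (z ^+ n *: x - iter n T x) <= c * rnorm x.
Proof.
move=> c0 Tz T1 z1.
have cn0 : 0 < c / n.+1%:R by rewrite divr_gt0.
have [x xc] := Tz _ cn0.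
have x0 : 0 < rnorm x.
  by have := le_lt_trans (rnorm_ge0 _) xc; rewrite pmulr_rgt0.
exists x => //.
have T1n k y : rnorm (iter k T y) <= rnorm y.
  by elim: k => //= k; apply: le_trans.
suff h : rnorm (z ^+ n *: x - iter n T x) <= n%:R * rnorm (z *: x - T x).
  rewrite (le_trans h)//.
  rewrite (@le_trans _ _ (n%:R * (c / n.+1%:R * rnorm x)))//.
    by rewrite ler_wpM2l// ltW.
  rewrite mulrA ler_wpM2r ?rnorm_ge0// mulrCA -[leRHS]mulr1.
  by rewrite ler_wpM2l ?(ltW c0)// ler_pdivrMr// mul1r ler_nat.
elim: n {cn0 xc} => [|n IH]; first by rewrite expr0 scale1r subrr rnorm0 mul0r.
have -> : z ^+ n.+1 *: x - iter n.+1 T x =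
    z *: (z ^+ n *: x - iter n T x) + iter n T (z *: x - T x).
  have -> : iter n T (z *: x - T x) = z *: iter n T x - iter n.+1 T x.
    rewrite iterSr; elim: n {IH} => //= n ->; by rewrite linearB linearZ.
  by rewrite scalerBr scalerA exprS subrKA.
rewrite (le_trans (rnormD _ _))// rnormZ -(addn1 n) natrD mulrDl mul1r lerD//.
by rewrite (le_trans _ IH)// ler_piMl ?rnorm_ge0.
Qed.

Lemma approx_eigenvalue_le1 T z : (forall x, rnorm (T x) <= rnorm x) ->
  approx_eigenvalue T z -> rnorm z <= 1.
Proof.
move=> T1 Tz; apply/ler_addgt0Pr => c c0; have [x xc] := Tz _ c0.
have x0 : 0 < rnorm x.
  by have := le_lt_trans (rnorm_ge0 _) xc; rewrite pmulr_rgt0.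
rewrite -(ler_pM2r x0) mulrDl mul1r -lerBlDl -rnormZ.
by rewrite (le_trans _ (ltW xc))// (le_trans _ (rnormBB _ _))// lerD2l lerN2.
Qed.

(** The half of the spectral mapping theorem that is needed: an approximate
    eigenvector of [T] at [z] is one of [1 - T^n] at [1 - z^n]. *)
Lemma approx_eigenvalue_displacement T z n :
  (forall x, rnorm (T x) <= rnorm x) ->
  approx_eigenvalue T z ->
  (forall x, rnorm (x - iter n T x) <= rnorm x) -> rnorm (1 - z ^+ n) <= 1.
Proof.
move=> T1 Tz Tn; apply/ler_addgt0Pr => c c0.
have z1 := approx_eigenvalue_le1 T1 Tz.
have [x x0 xc] := approx_eigenvalue_pow n c0 Tz T1 z1.
rewrite -(ler_pM2r x0) -rnormZ mulrDl mul1r.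
have -> : (1 - z ^+ n) *: x = (x - iter n T x) - (z ^+ n *: x - iter n T x).
  by rewrite scalerBl scale1r opprB subrKA.
by rewrite (le_trans (rnormB _ _))// lerD.
Qed.

End approximate_spectrum.

(** * The unit circle *)

Section circle.
Context {R : realType}.
Implicit Types (t d : R) (z : R[i]).

(** The point [exp (i t)] of the unit circle. *)
Definition cis t : R[i] := cos t +i* sin t.

Lemma rnorm_cis t : rnorm (cis t) = 1.
Proof. by rewrite /rnorm normc_def/= cos2Dsin2 sqrtr1. Qed.

Lemma rnorm1_cis z : rnorm z = 1 -> exists2 t, - pi <= t <= pi & z = cis t.
Proof.
move=> z1; have := rnorm_sqr z; rewrite z1 expr1n; case: z {z1} => a b /= ab.
have a1 : -1 <= a <= 1 by have := sqr_ge0 b; move=> ?; apply/andP; split; nra.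
have s : Num.sqrt (1 - a ^+ 2) = `|b|.
  have -> : 1 - a ^+ 2 = b ^+ 2 by rewrite ab addrC addKr.
  by rewrite sqrtr_sqr.
have cK : cos (acos a) = a by rewrite acosK.
have [p0 p1] := (acos_ge0 a1, acos_lepi a1).
have [b0|b0] := leP 0 b.
  exists (acos a); first by apply/andP; split=> //; rewrite (le_trans _ p0)// oppr_le0 pi_ge0.
  by rewrite /cis cK sin_acos// s ger0_norm.
exists (- acos a); first by rewrite lerN2 p1 lerNl (le_trans _ p0)// oppr_le0 pi_ge0.
by rewrite /cis cosN cK sinN sin_acos// s ltr0_norm// opprK.
Qed.

Lemma rnorm_geRe z : `|complex.Re z| <= rnorm z.
Proof.
rewrite -(@ler_pXn2r _ 2%N)// ?nnegrE ?rnorm_ge0//.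
by rewrite real_normK ?num_real// rnorm_sqr lerDl sqr_ge0.
Qed.

Lemma rnorm_geIm z : `|complex.Im z| <= rnorm z.
Proof.
rewrite -(@ler_pXn2r _ 2%N)// ?nnegrE ?rnorm_ge0//.
by rewrite real_normK ?num_real// rnorm_sqr lerDr sqr_ge0.
Qed.

Lemma rnorm_leReIm z : rnorm z <= `|complex.Re z| + `|complex.Im z|.
Proof.
rewrite -(@ler_pXn2r _ 2%N)// ?nnegrE ?addr_ge0 ?rnorm_ge0//.
rewrite rnorm_sqr sqrrD !real_normK ?num_real// lerD2r lerDl.
by rewrite mulrn_wge0// mulr_ge0.
Qed.

(** Compactness of the circle, in the form in which it is used: a positive
    margin that can be chosen locally can be chosen globally.  Compactness is
    that of the interval of angles. *)
Lemma circle_uniform (P : R -> R[i] -> Prop) :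
  (forall z, rnorm z = 1 -> exists2 d, 0 < d &
    forall d' w, 0 < d' <= d -> rnorm (w - z) <= d -> P d' w) ->
  exists2 d, 0 < d & forall z, rnorm z = 1 -> P d z.
Proof.
move=> loc.
have /compact_near_coveringP cpt := @segment_compact R (- pi) pi.
have [|e e0 eP] := (_ : \forall d \near 0^'+, `[- pi, pi] `<=` (fun t => P d (cis t))).
  apply: cpt => t _; have [d d0 dP] := loc _ (rnorm_cis t).
  have d2 : 0 < d / 2 by rewrite divr_gt0.
  have ct : \forall s \near t, `|cos s - cos t| <= d / 2.
    have /cvgrPdist_le/(_ _ d2) := @continuous_cos R t.
    by apply: filterS => s; rewrite distrC.
  have st : \forall s \near t, `|sin s - sin t| <= d / 2.
    have /cvgrPdist_le/(_ _ d2) := @continuous_sin R t.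
    by apply: filterS => s; rewrite distrC.
  exists ([set s | `|cos s - cos t| <= d / 2 /\ `|sin s - sin t| <= d / 2],
    [set d' | 0 < d' /\ d' <= d]) => [|[s d'] /= [[cs ss] [d'0 d'd]]].
    by split; apply: filterI => //; [exact: nbhs_right_gt|exact: nbhs_right_le].
  apply: dP; first by rewrite d'0.
  by rewrite (le_trans (rnorm_leReIm _))//= (splitr d) lerD.
exists (e / 2); first by rewrite divr_gt0.
move=> z /rnorm1_cis[t tpi ->]; apply: eP; rewrite /= ?in_itv//=.
  by rewrite sub0r normrN ger0_norm ?divr_ge0 ?ltW// gtr_pMr// invf_lt1// ltr1n.
by rewrite divr_gt0.
Qed.

End circle.

(** * Norm and spectral radius of paranormal operators *)

Section polynomial_action.
Context {R : realType} {V : normedModType R[i]} (S : {linear V -> V}).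
Implicit Types (p q : {poly R[i]}) (x y : V) (c : R[i]).

(** The vector [p(S) x].  Acting by polynomials turns identities between
    commuting operators into identities of a commutative ring. *)
Definition pact p x : V := \sum_(i < size p) p`_i *: iter i S x.

Lemma pactE n p x : (size p <= n)%N -> pact p x = \sum_(i < n) p`_i *: iter i S x.
Proof.
move=> pn; rewrite /pact (big_ord_widen n (fun i => p`_i *: iter i S x))//.
rewrite big_mkcond/=; apply: eq_bigr => i _; case: ltnP => // ip.
by rewrite nth_default// scale0r.
Qed.

Lemma pactD p q x : pact (p + q) x = pact p x + pact q x.
Proof.
pose n := maxn (size p) (size q).
rewrite (@pactE n) ?size_polyD// (@pactE n p) ?leq_maxl// (@pactE n q) ?leq_maxr//.
by rewrite -big_split/=; apply: eq_bigr => i _; rewrite coefD scalerDl.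
Qed.

Lemma pactZ c p x : pact (c *: p) x = c *: pact p x.
Proof.
rewrite (@pactE (size p)) ?size_scale_leq// /pact scaler_sumr.
by apply: eq_bigr => i _; rewrite coefZ scalerA.
Qed.

Lemma pactB p q x : pact (p - q) x = pact p x - pact q x.
Proof. by rewrite -scaleN1r pactD pactZ scaleN1r. Qed.

Lemma pactMX p x : pact (p * 'X) x = pact p (S x).
Proof.
rewrite (@pactE (size p).+1) ?(leq_trans (size_polyMleq _ _)) ?size_polyX ?addn2//.
rewrite big_ord_recl/= coefMX eqxx scale0r add0r /pact.
by apply: eq_bigr => i _; rewrite coefMX/= -iterSr.
Qed.

Lemma pact1 x : pact 1 x = x.
Proof. by rewrite /pact size_poly1 big_ord1 coef1 scale1r. Qed.

Lemma pactXn n x : pact 'X^n x = iter n S x.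
Proof. by elim: n x => [|n IH] x; [rewrite expr0 pact1|rewrite exprSr pactMX IH -iterSr]. Qed.

Lemma pactS p x : S (pact p x) = pact p (S x).
Proof.
rewrite /pact linear_sum; apply: eq_bigr => i _.
by rewrite linearZ/= -iterSr.
Qed.

Lemma pactM p q x : pact (p * q) x = pact p (pact q x).
Proof.
elim/poly_ind: p x => [|p c IH] x.
  by rewrite mul0r -(scale0r 0) !pactZ !scale0r.
rewrite mulrDl !pactD mul_polyC pactZ -[c%:P]mulr1 mul_polyC pactZ pact1; congr (_ + _).
by rewrite mulrAC !pactMX IH pactS.
Qed.

End polynomial_action.

Lemma bernoulli_ineq (R : realFieldType) (x : R) n : -1 <= x ->
  1 + n%:R * x <= (1 + x) ^+ n.
Proof.
move=> x1; elim: n => [|n IH]; first by rewrite mul0r addr0 expr0.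
have h : 0 <= 1 + x by lra.
have h2 : 0 <= n%:R * x ^+ 2 by rewrite mulr_ge0 ?sqr_ge0.
rewrite exprS; apply: le_trans (ler_wpM2l h IH); rewrite -natr1; nra.
Qed.

(** An operator [S] with [|S x| <= |x|] and [|S x|^2 <= |S^2 x| |x|] whose
    approximate eigenvalues avoid the unit circle has norm less than [1].
    This plays the part of the spectral radius formula.
    With [D n w = 1 - w^n X^n] one has
    [1 / D n w = (1 / n) sum_o (1 / D 1 (o w))] over the [n]-th roots of unity
    [o], so an estimate of [1 / D 1 (a w) - 1 / D 1 (b w)] that is uniform in
    [w] on the circle passes to [1 / D n (a w) - 1 / D n (b w)] with the same
    constant.  For [b < 1 < a] close to [1] and large [n], [b^n S^n] stays
    bounded while [a^n] explodes, which forces [S^n] to be small; by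
    paranormality [|S^n x|] is at least of order [|S x|^n], so [S] is a strict
    contraction.  Only the powers [n = 2^k] occur, for which the average over
    roots of unity is an iterated average of two terms. *)
Section paranormal_spectral_radius.
Context {R : realType} {H : hilbertType R}.
Variable S : {linear H -> H}.
Hypotheses (S1 : forall x, rnorm (S x) <= rnorm x)
  (Spn : forall x, rnorm (S x) ^+ 2 <= rnorm (S (S x)) * rnorm x).

Let iterS_le n x : rnorm (iter n S x) <= rnorm x.
Proof. by elim: n => //= n; exact: le_trans. Qed.

(* The sequence |S^k x| is log-convex. *)
Let iterS_ge n x (q : R) : 0 <= q -> q * rnorm x <= rnorm (S x) ->
  q ^+ n * rnorm x <= rnorm (iter n S x).
Proof.
move=> q0 qx.
have [x0|x0] := eqVneq (rnorm x) 0; first by rewrite x0 mulr0 rnorm_ge0.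
have {}x0 : 0 < rnorm x by rewrite lt_neqAle eq_sym x0 rnorm_ge0.
have step k : rnorm (S x) * rnorm (iter k S x) <= rnorm (iter k.+1 S x) * rnorm x.
  elim: k => [|k IH]; first by rewrite mulrC.
  have := Spn (iter k S x); rewrite -!iterS.
  move: IH (rnorm_ge0 (iter k S x)) (iterS_le k x)
    (rnorm_ge0 (iter k.+1 S x)) (rnorm_ge0 (S x))
    (rnorm_ge0 (iter k.+2 S x)) (S1 (iter k S x)).
  rewrite -iterS; set u := rnorm (iter k S x); set v := rnorm (iter k.+1 S x).
  set w := rnorm (iter k.+2 S x); set s := rnorm (S x); set r := rnorm x.
  move=> h u0 ur v0 s0 w0 vu vuw.
  move: u0; rewrite le_eqVlt => /predU1P[u0|u0].
    have -> : v = 0 by apply/eqP; rewrite eq_le v0 andbT u0.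
    by rewrite mulr0 mulr_ge0// rnorm_ge0.
  rewrite -(ler_pM2r u0).
  have : v * (s * u) <= v * (v * r) by rewrite ler_wpM2l.
  have : v ^+ 2 * r <= w * u * r by rewrite ler_wpM2r// rnorm_ge0.
  by rewrite expr2; lra.
elim: n => [|n IH]; first by rewrite expr0 mul1r.
rewrite -(ler_pM2r x0); apply: le_trans (step n).
have -> : q ^+ n.+1 * rnorm x * rnorm x = q * rnorm x * (q ^+ n * rnorm x).
  by rewrite exprS; ring.
by rewrite ler_pM// mulr_ge0 ?exprn_ge0 ?rnorm_ge0.
Qed.

Let D n (w : R[i]) : {poly R[i]} := 1 - (w ^+ n)%:P * 'X^n.

Let pactDE n w x : pact S (D n w) x = x - w ^+ n *: iter n S x.
Proof. by rewrite pactB pact1 mul_polyC pactZ pactXn. Qed.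

Let D_double n w o : o ^+ n = -1 -> D (n + n) w = D n w * D n (o * w).
Proof.
move=> on; rewrite /D exprMn on exprD polyCM exprD polyCM polyCN; ring.
Qed.

Let rnorm_root n (o : R[i]) : (0 < n)%N -> o ^+ n = -1 -> rnorm o = 1.
Proof.
move=> n0 on; apply/eqP; rewrite -(@pexpr_eq1 _ _ n)//; last exact: rnorm_ge0.
by rewrite -crnormX on rnormN crnorm1.
Qed.

(** The differences of inverses are multiplied through by the denominators,
    so that no invertibility is needed. *)
Let D_averaging (a b : R) (e : R) :
  (forall w, rnorm w = 1 -> forall x,
    rnorm (pact S (D 1 (a%:C * w) - D 1 (b%:C * w)) x) <=
    e * rnorm (pact S (D 1 (a%:C * w) * D 1 (b%:C * w)) x)) ->
  forall k w, rnorm w = 1 -> forall x,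
    rnorm (pact S (D (2 ^ k) (a%:C * w) - D (2 ^ k) (b%:C * w)) x) <=
    e * rnorm (pact S (D (2 ^ k) (a%:C * w) * D (2 ^ k) (b%:C * w)) x).
Proof.
move=> base; elim=> [|k IH] w w1 x; first exact: base.
set n := (2 ^ k)%N; have n0 : (0 < n)%N by rewrite expn_gt0.
pose o : R[i] := n.-root (-1).
have on : o ^+ n = -1 by rewrite rootCK.
have ow1 : rnorm (o * w) = 1 by rewrite crnormM w1 (rnorm_root n0 on) mulr1.
rewrite expnS mul2n -addnn !(D_double _ on) !(mulrCA o).
set A := D n (a%:C * w); set A' := D n (a%:C * (o * w)).
set B := D n (b%:C * w); set B' := D n (b%:C * (o * w)).
have AA : A + A' = 2 by rewrite /A /A' /D !exprMn on !polyCM polyCN; ring.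
have BB : B + B' = 2 by rewrite /B /B' /D !exprMn on !polyCM polyCN; ring.
have -> : A * A' - B * B' = 2^-1 *: ((A - B) * (A' * B') + (A' - B') * (A * B)).
  have -> : A' = 2 - A by rewrite -AA; ring.
  have -> : B' = 2 - B by rewrite -BB; ring.
  apply: (@scalerI _ _ (2 : R[i])); rewrite ?pnatr_eq0// scalerA divff ?pnatr_eq0// scale1r.
  by rewrite -mul_polyC polyCMn; ring.
have h1 : rnorm (pact S ((A - B) * (A' * B')) x) <= e * rnorm (pact S (A * A' * (B * B')) x).
  rewrite (_ : A * A' * (B * B') = A * B * (A' * B')); last by ring.
  by rewrite (pactM S (A - B)) (pactM S (A * B)); exact: IH.
have h2 : rnorm (pact S ((A' - B') * (A * B)) x) <= e * rnorm (pact S (A * A' * (B * B')) x).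
  rewrite (_ : A * A' * (B * B') = A' * B' * (A * B)); last by ring.
  by rewrite (pactM S (A' - B')) (pactM S (A' * B')); exact: IH.
(* The factor of the average 1 / (A A') = (1 / A + 1 / A') / 2. *)
have half : rnorm (2^-1 : R[i]) = 2^-1.
  by rewrite crnormV -(rmorph_nat (real_complex R)) crnorm_real normr_nat.
rewrite pactZ pactD rnormZ half.
have h3 := rnormD (pact S ((A - B) * (A' * B')) x) (pact S ((A' - B') * (A * B)) x).
rewrite ler_pdivrMl ?ltr0n// (le_trans h3)// (le_trans (lerD h1 h2))//.
by rewrite -mulr2n -[leLHS]mulr_natl.
Qed.

Lemma paranormal_spectral_radius :
  (forall z, rnorm z = 1 -> ~ approx_eigenvalue S z) ->
  exists2 q : R, 0 <= q < 1 & forall x, rnorm (S x) <= q * rnorm x.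
Proof.
move=> noev.
have [d0 d00 bb] : exists2 d : R, 0 < d & forall z, rnorm z = 1 -> bounded_below S z d.
  apply: circle_uniform => z z1.
  have [c c0 Sc] := (bounded_belowP S z).2 (noev z z1).
  exists (c / 2); first by rewrite divr_gt0.
  move=> d' w /andP[d'0 d'c] wz; have Sw := bounded_below_near Sc wz.
  by move=> x; rewrite (le_trans _ (Sw x))// ler_wpM2r ?rnorm_ge0//; lra.
pose d := Num.min d0 1.
have d_gt0 : 0 < d by rewrite lt_min d00 ltr01.
have d_le1 : d <= 1 by rewrite ge_min lexx orbT.
have {}bb z x : rnorm z = 1 -> d * rnorm x <= rnorm (x - z *: S x).
  move=> z1; have z0 : z != 0 by rewrite -rnorm_eq0 z1 oner_eq0.
  have := bb z^-1 _ x; rewrite crnormV z1 invr1 => /(_ erefl) h.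
  have -> : x - z *: S x = z *: (z^-1 *: x - S x).
    by rewrite scalerBr scalerA divff// scale1r.
  rewrite rnormZ z1 mul1r (le_trans _ h)// ler_wpM2r ?rnorm_ge0//.
  by rewrite ge_min lexx.
(* Chosen so that 2 eta (2 / d) ^ 2 = 1 / 4, the constant in base. *)
pose eta := d ^+ 2 / 32.
have eta0 : 0 < eta by rewrite divr_gt0 ?exprn_gt0.
have eta2 : eta <= d / 2.
  by rewrite /eta; nra.
have bbt z t x : rnorm z = 1 -> `|t - 1| <= eta ->
    d / 2 * rnorm x <= rnorm (x - (t%:C * z) *: S x).
  move=> z1 t1; have := bb z x z1.
  have -> : x - z *: S x = (x - (t%:C * z) *: S x) + ((t - 1)%:C * z) *: S x.
    by rewrite rmorphB/= mulrBl mul1r scalerBl addrA subrK.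
  move=> h; have := le_trans h (rnormD _ _); rewrite rnormZ crnormM z1 mulr1 crnorm_real.
  have : `|t - 1| * rnorm (S x) <= d / 2 * rnorm x.
    by rewrite ler_pM ?rnorm_ge0// (le_trans t1).
  lra.
pose a := 1 + eta; pose b := 1 - eta.
have a1 : `|a - 1| <= eta by rewrite /a addrAC subrr add0r gtr0_norm.
have b1 : `|b - 1| <= eta by rewrite /b addrAC subrr add0r normrN gtr0_norm.
have base w : rnorm w = 1 -> forall x,
    rnorm (pact S (D 1 (a%:C * w) - D 1 (b%:C * w)) x) <=
    4^-1 * rnorm (pact S (D 1 (a%:C * w) * D 1 (b%:C * w)) x).
  move=> w1 x.
  have h1 := bbt w a (pact S (D 1 (b%:C * w)) x) w1 a1.
  have h2 := bbt w b x w1 b1.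
  have yE t : pact S (D 1 (t%:C * w)) =1 (fun y => y - (t%:C * w) *: S y).
    by move=> y; rewrite pactDE expr1.
  rewrite -yE in h1; rewrite -yE in h2.
  rewrite pactM pactB !(yE _ x) opprB addrC subrKA -scalerBl -mulrBl.
  rewrite rnormZ crnormM w1 mulr1 -rmorphB crnorm_real.
  have -> : `|b - a| = d ^+ 2 / 16.
    rewrite distrC (_ : a - b = d ^+ 2 / 16) ?ger0_norm ?divr_ge0 ?exprn_ge0 ?(ltW d_gt0)//.
    by rewrite /a /b /eta; field.
  have h3 := ler_wpM2l (_ : 0 <= d / 2) h2.
  have h4 := ler_wpM2l (_ : 0 <= d ^+ 2 / 16) (S1 x).
  have /h3 {}h3 : 0 <= d / 2 by lra.
  have /h4 {}h4 : 0 <= d ^+ 2 / 16 by rewrite divr_ge0 ?exprn_ge0 ?(ltW d_gt0).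
  by rewrite -yE; nra.
have key := D_averaging base.
have [k h8] : exists k, 8 <= a ^+ (2 ^ k).
  exists (Num.truncn (8 / eta)).+1.
  set m := (Num.truncn _).+1.
  have mge : 8 / eta <= m%:R by rewrite ltW// truncnS_gt.
  have : m%:R <= (2 ^ m)%:R :> R by rewrite ler_nat ltnW// ltn_expl.
  have := @bernoulli_ineq R eta (2 ^ m) _; rewrite -/a.
  have /[swap]/[apply] : -1 <= eta by lra.
  rewrite ler_pdivrMr// in mge.
  move=> h1 h2; have := ler_wpM2r (ltW eta0) h2; lra.
set n := (2 ^ k)%N in h8.
have n0 : (0 < n)%N by rewrite expn_gt0.
have n0R : 0 < n%:R :> R by rewrite ltr0n.
have n1R : 1 <= n%:R :> R by rewrite ler1n.
have dec x : rnorm (iter n S x) <= 6^-1 * rnorm x.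
  have DE t y : pact S (D n (t%:C * 1)) y = y - (t ^+ n)%:C *: iter n S y.
    by rewrite (mulr1 t%:C) pactDE -rmorphXn.
  have := key k 1 crnorm1 x; rewrite -/n.
  move: (DE a) (DE b) h8; set A := a ^+ n; set B := b ^+ n.
  move: (D n (a%:C * 1)) (D n (b%:C * 1)) => P Q PE QE h8.
  rewrite pactM pactB !PE !QE opprB addrC subrKA -scalerBl -rmorphB.
  rewrite rnormZ crnorm_real.
  have B01 : 0 <= B <= 1.
    by apply/andP; split; [apply: exprn_ge0|apply: exprn_ile1]; rewrite /b; lra.
  have [B0 B1] := andP B01.
  rewrite distrC ger0_norm; last by rewrite subr_ge0 (le_trans B1)// (le_trans _ h8)// ler1n.
  have iterB y : iter n S (x - B%:C *: y) = iter n S x - B%:C *: iter n S y.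
    by elim: (n) => //= m ->; rewrite linearB linearZ.
  rewrite iterB.
  have hB (y : H) : rnorm (B%:C *: y) <= rnorm y.
    by rewrite rnormZ crnorm_real ger0_norm// ler_piMl ?rnorm_ge0.
  have := rnormB (x - B%:C *: iter n S x)
    (A%:C *: (iter n S x - B%:C *: iter n S (iter n S x))).
  have := rnormB x (B%:C *: iter n S x); have := hB (iter n S x); have := iterS_le n x.
  have := rnormB (iter n S x) (B%:C *: iter n S (iter n S x)).
  have := hB (iter n S (iter n S x)); have := iterS_le n (iter n S x).
  have A0 : 0 <= A by rewrite (le_trans _ h8).
  rewrite [rnorm (A%:C *: _)]rnormZ crnorm_real (ger0_norm A0).
  set u := rnorm (iter n S x); set r := rnorm x.
  set y := iter n S x - B%:C *: _.
  move=> g1 g2 g3 g4 g5 g6 g7 g8.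
  have g9 : A * rnorm y <= A * (u + u) by rewrite ler_wpM2l//; lra.
  have u0 : 0 <= u := rnorm_ge0 _.
  have g10 : 0 <= (A - 8) * u by rewrite mulr_ge0// subr_ge0.
  have g11 : B * u <= 1 * u by rewrite ler_wpM2r.
  lra.
(* By the Bernoulli inequality q ^ n >= 1 / 2, against the bound 1 / 6 on S^n. *)
pose q := 1 + - (2 * n%:R)^-1 : R.
have q2 : 2^-1 <= q ^+ n.
  apply: le_trans (bernoulli_ineq n _); last first.
    by rewrite lerN2 invf_le1 ?mulr_gt0//; lra.
  by rewrite invfM mulrN mulrCA divff ?gt_eqF//; lra.
have q01 : 0 <= q < 1.
  apply/andP; split; last by rewrite /q gtrDl oppr_lt0 invr_gt0 mulr_gt0.
  by rewrite /q subr_ge0 invf_le1 ?mulr_gt0//; lra.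
have [q0 q1] := andP q01.
exists q => // x; rewrite leNgt; apply/negP => Sx.
have := iterS_ge n q0 (ltW Sx); have := dec x.
have : 2^-1 * rnorm x <= q ^+ n * rnorm x by rewrite ler_wpM2r ?rnorm_ge0.
have : 0 < rnorm x by have := S1 x; have := mulr_ge0 q0 (rnorm_ge0 x); lra.
lra.
Qed.

End paranormal_spectral_radius.

(** * The function kappa and the Stolz estimate *)

Section trigonometry.
Context {R : realType}.
Implicit Types (t : R) (z : R[i]).

Lemma cisX t n : cis t ^+ n = cis (n%:R * t).
Proof.
elim: n => [|n IH]; first by rewrite expr0 mul0r /cis cos0 sin0.
rewrite exprS IH -natr1 mulrDl mul1r addrC /cis cosD sinD.
by apply/eqP; rewrite eq_complex/= [in X in _ && X]addrC (mulrC (sin t))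
   (mulrC (cos t) (sin _)) !eqxx.
Qed.

Lemma cos_norm_mul t n : cos (n%:R * `|t|) = cos (n%:R * t).
Proof. by have [_|_] := ger0P t => //; rewrite mulrN cosN. Qed.

Lemma sin_MVT t : 0 < t -> exists2 c, 0 < c < t & sin t = cos c * t.
Proof.
move=> t0; have ct : {within `[0, t], continuous (@sin R)}.
  by apply: continuous_subspaceT => x; exact: continuous_sin.
have [c] := MVT t0 (fun x _ => is_derive_sin x) ct.
by rewrite in_itv/= sin0 !subr0; exists c.
Qed.

Lemma cos_MVT t : 0 < t -> exists c, 1 - cos t = sin c * t.
Proof.
move=> t0; have ct : {within `[0, t], continuous (@cos R)}.
  by apply: continuous_subspaceT => x; exact: continuous_cos.
have [c _ E] := MVT t0 (fun x _ => is_derive_cos x) ct.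
by exists c; rewrite -opprB -[cos t - 1]/(cos t - 1) -{1}cos0 E subr0 mulNr opprK.
Qed.

Lemma rnorm_1Bcis t : rnorm (1 - cis t) <= 2 * `|t|.
Proof.
wlog : t / 0 < t => [h|t0].
  have [t0|t0|<-] := ltgtP 0 t; first exact: h.
    have <- : rnorm (1 - cis (- t)) = rnorm (1 - cis t).
      apply/eqP; rewrite -(@eqrXn2 _ 2%N) ?rnorm_ge0//; apply/eqP.
      by rewrite !rnorm_sqr/= cosN sinN !sub0r opprK sqrrN.
    by rewrite -(normrN t); apply: h; rewrite oppr_gt0.
  by rewrite /cis cos0 sin0 normr0 mulr0 -[_ +i* _]/(1 : R[i]) subrr rnorm0.
apply: (le_trans (rnorm_leReIm _)); rewrite /= sub0r normrN mulr2n mulrDl mul1r.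
have [c ->] := cos_MVT t0; have [c' _ ->] := sin_MVT t0.
by rewrite !normrM; apply: lerD; rewrite ler_piMl// ?sin_max ?cos_max.
Qed.

Lemma sin_lower_bound t : 0 < t <= 1 -> cos 1 * t <= sin t.
Proof.
move=> /andP[t0 t1]; have [c /andP[c0 ct] ->] := sin_MVT t0.
rewrite ler_pM2r//.
have c1 := lt_le_trans ct t1.
have pi1 : 1 <= pi :> R by have := @pi_ge2 R; lra.
rewrite ltW// ltr_cos// in_itv/=; apply/andP; split; lra.
Qed.

Lemma rnorm_1B_polar (r t : R) n :
  rnorm (1 - (r%:C * cis t) ^+ n) ^+ 2 =
  1 - r ^+ n * (2 * cos (n%:R * t) - r ^+ n).
Proof.
rewrite exprMn cisX -rmorphXn rnorm_sqr/=.
have := cos2Dsin2 (n%:R * t); move: (cos _) (sin _) => c s cs.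
by rewrite !mul0r subr0 addr0; nra.
Qed.

(** Squaring, [|1 - r^n e^(int)|^2 = 1 - r^n (2 cos (n t) - r^n)]. *)
Lemma displacement_polarP (r t : R) n : 0 < r ->
  (rnorm (1 - (r%:C * cis t) ^+ n) <= 1) = (r ^+ n <= 2 * cos (n%:R * t)).
Proof.
move=> r0; rewrite -(@ler_pXn2r _ 2%N)// ?nnegrE ?rnorm_ge0// expr1n.
by rewrite rnorm_1B_polar gerBl pmulr_rge0 ?exprn_gt0// subr_ge0.
Qed.

End trigonometry.

Section kappa_theory.
Context {R : realType} (N : set nat).
Hypothesis Npos : forall n, N n -> (0 < n)%N.
Implicit Types (t s r : R).

(** The meaning of [kappa]: at angle [t], the largest radius up to [1] at which all
    displacements [|1 - z^n|] are at most [1] is [exp (- kappa t)]. *)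
Lemma kappa_le_displacement t s : 0 <= s ->
  (kappa N t <= s%:E)%E <->
  forall n, N n -> rnorm (1 - ((expR (- s))%:C * cis t) ^+ n) <= 1.
Proof.
move=> s0; have e0 : 0 < expR (- s) by exact: expR_gt0.
split=> [+ n Nn|h].
  rewrite /kappa; case: ifPn => [_|/asboolPn cN kN]; first by rewrite leye_eq.
  have c0 : 0 < cos (n%:R * t).
    by rewrite ltNge; apply/negP => cn; apply: cN; exists n.
  have n0 : 0 < n%:R :> R by rewrite ltr0n Npos.
  rewrite displacement_polarP//.
  have : ((Num.max (- ln (2 * cos (n%:R * t))) 0 / n%:R)%:E <= s%:E)%E.
    by apply: le_trans kN; apply: ereal_sup_ubound; exists n.
  rewrite lee_fin ler_pdivrMr// ge_max => /andP[+ _].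
  rewrite lerNl => h; rewrite -[leRHS]lnK ?posrE ?mulr_gt0//.
  by rewrite -expRM_natr ler_expR mulNr.
have cp n : N n -> 0 < cos (n%:R * t).
  move=> Nn; have := h n Nn; rewrite displacement_polarP// => /(lt_le_trans (exprn_gt0 n e0)).
  by rewrite pmulr_rgt0.
rewrite /kappa; case: ifPn => [/asboolP[n Nn]|_]; first by rewrite leNgt cp.
apply: ge_ereal_sup => _ [n Nn <-]; have n0 : 0 < n%:R :> R by rewrite ltr0n Npos.
rewrite lee_fin ler_pdivrMr// ge_max mulr_ge0 ?ler0n// andbT lerNl.
have := h n Nn; rewrite displacement_polarP// -expRM_natr => h2.
by rewrite -ler_expR lnK ?posrE ?mulr_gt0 ?cp// -mulNr.
Qed.

Lemma kappa_norm t : kappa N `|t| = kappa N t.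
Proof.
rewrite /kappa; congr (if _ then _ else _).
  by congr asbool; rewrite propeqE; split=> -[n Nn ct]; exists n => //;
    rewrite ?cos_norm_mul// -cos_norm_mul.
by congr ereal_sup; apply: eq_imagel => n Nn; rewrite cos_norm_mul.
Qed.

(** A point [z = r e^(it)] with all displacements at most [1] satisfies
    [kappa t <= - ln r <= 2 (1 - r)], so a linear lower bound on [kappa]
    gives [c |t| <= 2 (1 - r)]: the point lies in a Stolz domain at [1]. *)
Lemma stolz_estimate (c r t : R) : 0 < c -> 2^-1 <= r <= 1 ->
  (t != 0 -> (c%:E <= kappa N `|t| * (`|t|^-1)%:E)%E) ->
  (forall n, N n -> rnorm (1 - (r%:C * cis t) ^+ n) <= 1) ->
  rnorm (1 - r%:C * cis t) <= (1 + 4 / c) * (1 - r).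
Proof.
move=> c0 /andP[r2 r1] ck h.
have r0 : 0 < r by rewrite (lt_le_trans _ r2)// invr_gt0.
have ct : c * `|t| <= 2 * (1 - r).
  have [->|t0] := eqVneq t 0; first by rewrite normr0 mulr0 mulr_ge0// subr_ge0.
  have lnr : - ln r <= 2 * (1 - r).
    rewrite -lnV//; have rV : r^-1 <= 2 by rewrite -[leRHS]invrK lef_pV2// posrE invr_gt0.
    have := @le_ln1Dx R (r^-1 - 1); rewrite addrCA subrr addr0.
    have -> : -1 < r^-1 - 1 by have := invr_gt0 r; rewrite r0; lra.
    move=> /(_ isT) /le_trans; apply.
    have -> : r^-1 - 1 = r^-1 * (1 - r) by rewrite mulrBr mulVf ?gt_eqF// mulr1.
    by rewrite ler_wpM2r// subr_ge0.
  have ln0 : 0 <= - ln r by rewrite oppr_ge0 ln_le0.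
  have : (kappa N t <= (- ln r)%:E)%E.
    by apply/kappa_le_displacement => //; rewrite opprK lnK// posrE.
  rewrite -kappa_norm; have := ck t0; set k := kappa _ _ => ck' kl.
  apply: le_trans lnr; rewrite -ler_pdivlMr ?normr_gt0//.
  rewrite -lee_fin EFinM (le_trans ck')// lee_wpmul2r// lee_fin invr_ge0//.
have -> : 1 - r%:C * cis t = (1 - cis t) + (1 - r)%:C * cis t.
  by rewrite rmorphB/= mulrBl mul1r addrA subrK.
apply: (le_trans (rnormD _ _)); rewrite crnormM rnorm_cis mulr1 crnorm_real.
rewrite ger0_norm ?subr_ge0// mulrDl mul1r addrC lerD2l.
apply: (le_trans (rnorm_1Bcis t)).
have -> : 4 / c * (1 - r) = 2 * (2 * (1 - r) / c) by field; rewrite gt_eqF.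
by rewrite ler_pM2l// ler_pdivlMr// mulrC.
Qed.

End kappa_theory.

(** * Normal contractions with spectrum in a Stolz domain *)

Section ritt_criterion.
Context {R : realType} {H : hilbertType R}.
Implicit Types (x y : H) (T : {linear H -> H}) (z : R[i]).

(** The resolvent at [z] of a normal operator has norm at most the inverse of
    the distance from [z] to the spectrum: scaled to norm [1] it is
    paranormal, so [paranormal_spectral_radius] provides an approximate
    eigenvalue [m] on the circle, and [w = z - 1 / (r m)] is one of [T]. *)
Lemma resolvent_norm_approx_eigenvalue T z (S : H -> H) (r : R) :
  normal_op T -> is_resolvent T z S -> opnorm S = r%:E -> 0 < r ->
  exists2 w, approx_eigenvalue T w & rnorm (z - w) = r^-1.
Proof.
move=> nT [Slin _ SK KS] Sr r0; have rV0 : 0 < r^-1 by rewrite invr_gt0.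
have SZ := linear_scalable Slin.
have /(opnorm_leP SZ (ltW r0)) SM : (opnorm S <= r%:E)%E by rewrite Sr.
pose S0 x := r^-1%:C *: S x.
have S0lin : linear S0.
  by move=> a x y; rewrite /S0 Slin scalerDr !scalerA mulrC.
pose S' : {linear H -> H} := HB.pack S0 (GRing.isLinear.Build _ _ _ _ S0 S0lin).
have nS' x : rnorm (S' x) = r^-1 * rnorm (S x).
  by rewrite rnormZ crnorm_real gtr0_norm.
have S'1 x : rnorm (S' x) <= rnorm x by rewrite nS' mulrC ler_pdivrMr// mulrC.
have [A [B [AE adj com]]] := normal_shift z nT.
have S'pn x : rnorm (S' x) ^+ 2 <= rnorm (S' (S' x)) * rnorm x.
  have := normal_paranormal (S (S x)) adj com; rewrite !AE !SK => h.
  have -> : rnorm (S' (S' x)) = r^-1 ^+ 2 * rnorm (S (S x)).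
    by rewrite nS' [S' x]/(S0 x) /S0 SZ rnormZ crnorm_real gtr0_norm// mulrA -expr2.
  by rewrite nS' exprMn -[leRHS]mulrA ler_wpM2l ?sqr_ge0// mulrC.
have [[w w1 Sw]|noev] := pselect (exists2 w, rnorm w = 1 & approx_eigenvalue S' w).
  have w0 : w != 0 by rewrite -rnorm_eq0 w1 oner_eq0.
  have rC0 : r%:C != 0 :> R[i] by rewrite (inj_eq (@complexI R)) gt_eqF.
  exists (z - (r%:C * w)^-1); last first.
    by rewrite opprB addrC subrK crnormV crnormM w1 mulr1 crnorm_real gtr0_norm.
  (* An approximate eigenvector x of the resolvent is replaced by S x, whose norm
     is at least r / 2 times that of x. *)
  move=> c c0; pose d := Num.min (2^-1) (c * r / 2).
  have d0 : 0 < d by rewrite lt_min invr_gt0 ltr0n divr_gt0 ?mulr_gt0.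
  have d2 : d <= 2^-1 by rewrite ge_min lexx.
  have dc : d <= c * r / 2 by rewrite ge_min lexx orbT.
  have [x xd] := Sw _ d0; exists (S x).
  have x0 : 0 < rnorm x.
    by have := le_lt_trans (rnorm_ge0 _) xd; rewrite pmulr_rgt0.
  have -> : (z - (r%:C * w)^-1) *: S x - T (S x) = w^-1 *: (w *: x - S' x).
    rewrite scalerBl addrAC SK scalerBr scalerA mulVf// scale1r scalerA.
    by rewrite invfM mulrC fmorphV.
  rewrite rnormZ crnormV w1 invr1 mul1r (lt_le_trans xd)//.
  have := rnormBB (w *: x) (S' x); rewrite rnormZ w1 mul1r nS'.
  set s := rnorm (S x); set u := rnorm x in x0 xd * => h.
  have h1 : 2^-1 * u <= r^-1 * s.
    have : d * u <= 2^-1 * u by rewrite ler_wpM2r// ltW.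
    lra.
  have : d * u <= c * r / 2 * u by rewrite ler_wpM2r// ltW.
  move=> /le_trans; apply.
  have cr0 : 0 <= c * r by rewrite mulr_ge0 ?(ltW c0) ?(ltW r0).
  by have := ler_wpM2l cr0 h1; rewrite [c * r * (r^-1 * s)]mulrA mulfK ?gt_eqF// mulrA.
have [|q /andP[q0 q1] Sq] := paranormal_spectral_radius S'1 S'pn.
  by move=> w w1 Sw; apply: noev; exists w.
have : (opnorm S <= (q * r)%:E)%E.
  apply/opnorm_leP => //; first by rewrite mulr_ge0// ltW.
  by move=> x; have := Sq x; rewrite nS' mulrC ler_pdivrMr// mulrAC.
by rewrite Sr lee_fin leNgt gtr_pMl// q1.
Qed.

(** For [w] in the spectrum and [|z| > 1],
    [|z - 1| <= |z - w| + K (1 - |w|) <= (1 + K) |z - w|], and [|z - w|] can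
    be taken equal to the inverse of the norm of the resolvent. *)
Lemma normal_contraction_ritt T (K : R) : normal_op T -> (opnorm T <= 1)%E ->
  0 <= K ->
  (forall z, approx_eigenvalue T z -> rnorm (1 - z) <= K * (1 - rnorm z)) ->
  ritt T.
Proof.
move=> nT T1 K0 TK.
have Tfin : (opnorm T < +oo)%E by rewrite (le_lt_trans T1)// ltry.
have /(opnorm_leP (linearZ_LR T) ler01) {}T1 := T1.
have {}T1 x : rnorm (T x) <= rnorm x by have := T1 x; rewrite mul1r.
have specT z : spectrum T z -> rnorm z <= 1.
  by move=> /(spectrum_approx_eigenvalue nT Tfin)/approx_eigenvalue_le1; apply.
split=> // [z /specT|]; first by rewrite /= rnorm_le1.
apply: (@le_lt_trans _ _ (1 + K)%:E); last by rewrite ltry.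
apply: ge_ereal_sup => _ [z /= z1 <-].
have {}z1 : 1 < rnorm z by rewrite -crnorm_gt1.
have : ~ spectrum T z by move=> /specT; rewrite leNgt z1.
move=> /contrapT /(xgetPex (fun=> 0)); rewrite -/(resolvent T z).
set S := resolvent T z => SP; have [Slin Sfin _ _] := SP.
have [r r0 Sr] := opnorm_finP (linear_scalable Slin) Sfin.
rewrite Sr -EFinM lee_fin.
move: r0; rewrite le_eqVlt => /predU1P[<-|r0]; first by rewrite mulr0 addr_ge0.
have [w Tw zw] := resolvent_norm_approx_eigenvalue nT SP Sr r0.
rewrite -ler_pdivlMr// -zw mulrDl mul1r.
have := TK w Tw; rewrite rnorm_distC => h.
have := rnormD (z - w) (w - 1); rewrite subrKA => /le_trans; apply.
rewrite lerD2l (le_trans h)// ler_wpM2l//.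
by have := rnormBB z w; lra.
Qed.

(** Near [1] the Stolz estimate comes from the lower bound on [kappa]; on the
    rest of the circle [T - z] is bounded below, uniformly by compactness, so
    the spectrum away from [1] stays at a positive distance from the circle,
    where [1 - |z|] is bounded below and any large [K] works. *)
Lemma stolz_of_kappa (N : set nat) (Npos : forall n, N n -> (0 < n)%N)
    T (c t0 : R) : 0 < c -> 0 < t0 ->
  (forall t, 0 < t < t0 -> (c%:E <= kappa N t * (t^-1)%:E)%E) ->
  (opnorm T <= 1)%E ->
  peripheral_spectrum T `<=` [set 1] -> (power_displacement N T <= 1)%E ->
  exists2 K : R, 0 <= K &
    forall z, approx_eigenvalue T z -> rnorm (1 - z) <= K * (1 - rnorm z).
Proof.
move=> c0; wlog : t0 / t0 <= pi => [h t00 kc|tpi t00 kc T1 Tper TN].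
  apply: (h (Num.min t0 pi)); first by rewrite ge_min lexx orbT.
    by rewrite lt_min t00 pi_gt0.
  by move=> t /andP[tp]; rewrite lt_min => /andP[tt _]; apply: kc; rewrite tp.
have /(opnorm_leP (linearZ_LR T) ler01) {}T1 := T1.
have {}T1 x : rnorm (T x) <= rnorm x by have := T1 x; rewrite mul1r.
have evN z : approx_eigenvalue T z -> forall n, N n -> rnorm (1 - z ^+ n) <= 1.
  move=> Tz n Nn; apply: (approx_eigenvalue_displacement T1 Tz).
  have Tns : scalable (fun x => x - iter n T x).
    have it : scalable (iter n T) by move=> a x; elim: (n) => //= m ->; rewrite linearZ.
    by move=> a x; rewrite it scalerBr.
  have /(opnorm_leP Tns ler01) h : (opnorm (fun x => (x - iter n T x)%R) <= 1)%E.
    by apply: le_trans TN; apply: ereal_sup_ubound; exists n.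
  by move=> x; have := h x; rewrite mul1r.
have cost0 : cos t0 < 1.
  by rewrite -cos0 ltr_cos// in_itv/= ?lexx ?pi_ge0// tpi ltW.
have [d d0 dP] : exists2 d, 0 < d & forall z, rnorm z = 1 ->
    cos t0 < complex.Re z \/ bounded_below T z d.
  apply: (@circle_uniform R (fun d z => cos t0 < complex.Re z \/ bounded_below T z d)) => z z1.
  have [zt|zt] := ltP (cos t0) (complex.Re z).
    exists ((complex.Re z - cos t0) / 2); first by rewrite divr_gt0// subr_gt0.
    move=> d w _ wz; left; have := le_trans (rnorm_geRe (w - z)) wz.
    by rewrite raddfB/= ler_norml => /andP[+ _]; lra.
  have [|b b0 Tb] := (bounded_belowP T z).2 _.
    move=> /approx_eigenvalue_spectrum Tz.
    have /Tper z1' : peripheral_spectrum T z by split=> //=; apply/crnorm_norm1.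
    by move: zt; rewrite z1'/= leNgt cost0.
  exists (b / 2); first by rewrite divr_gt0.
  move=> d w /andP[d0 db] wz; right=> x.
  rewrite (le_trans _ (bounded_below_near Tb wz x))// ler_wpM2r ?rnorm_ge0//; lra.
have K10 : 0 <= 1 + 4 / c by rewrite addr_ge0// divr_ge0// ltW.
have K20 : 0 <= 2 * (2 / d + 2) by rewrite mulr_ge0 ?addr_ge0 ?divr_ge0 ?(ltW d0).
exists ((1 + 4 / c) + 2 * (2 / d + 2)); first exact: addr_ge0.
move=> z Tz; have z1 := approx_eigenvalue_le1 T1 Tz.
have [zfar|znear] := leP (2 / d + 2)^-1 (1 - rnorm z).
  have := rnormB 1 z; rewrite crnorm1 => /le_trans; apply.
  rewrite mulrDl ler_wpDl//; first by rewrite mulr_ge0// subr_ge0.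
  have d2 : 0 < 2 / d + 2 by rewrite addr_gt0// divr_gt0.
  have := ler_wpM2l (ltW d2) zfar; rewrite mulfV ?gt_eqF//; lra.
have [nd n2] : 1 - rnorm z < d /\ 1 - rnorm z < 2^-1.
  split; apply: (lt_le_trans znear).
    rewrite -[leRHS]invrK lef_pV2 ?posrE ?invr_gt0 ?addr_gt0 ?divr_gt0//.
    have : 0 < d^-1 by rewrite invr_gt0.
    lra.
  by rewrite lef_pV2 ?posrE ?addr_gt0 ?divr_gt0// lerDr divr_ge0// ltW.
have r0 : 0 < rnorm z by lra.
pose u := (rnorm z)^-1%:C * z.
have u1 : rnorm u = 1 by rewrite crnormM crnorm_real gtr0_norm ?invr_gt0// mulVf// gt_eqF.
have zu : z = (rnorm z)%:C * u.
  by rewrite mulrA -rmorphM/= mulfV ?gt_eqF// mul1r.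
have [t /andP[tpi0 tpi1] ut] := rnorm1_cis u1.
have uz : rnorm (u - z) = 1 - rnorm z.
  have -> : u - z = (1 - rnorm z)%:C * u by rewrite [in LHS]zu rmorphB/= mulrBl mul1r.
  by rewrite crnormM u1 mulr1 crnorm_real ger0_norm// subr_ge0.
have ev : cos t0 < cos t.
  case: (dP u u1); first by rewrite ut.
  move=> Tu; have Tz' : bounded_below T z (d - (1 - rnorm z)).
    by apply: bounded_below_near Tu _; rewrite rnorm_distC uz.
  by case: ((bounded_belowP T z).1 _ Tz); exists (d - (1 - rnorm z)); rewrite ?subr_gt0.
have tt0 : `|t| < t0.
  have ctt : cos `|t| = cos t by have := cos_norm_mul t 1; rewrite !mul1r.
  have m1 : `|t| \in `[0, pi] by rewrite in_itv/= normr_ge0 ler_norml tpi0.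
  have m2 : t0 \in `[0, pi] by rewrite in_itv/= tpi (ltW t00).
  by rewrite -(ltr_cos m1 m2) ctt.
rewrite {1}zu ut mulrDl ler_wpDr//; first by rewrite mulr_ge0// subr_ge0.
apply: (@stolz_estimate R N) => //; first by apply/andP; split; lra.
  by move=> tn0; apply: kc; rewrite normr_gt0 tn0.
by move=> n Nn; rewrite -ut -zu; exact: evN.
Qed.

End ritt_criterion.

(** * The lower limit at zero *)

Section liminf_kappa.
Context {R : realType}.
Implicit Types (f : R -> \bar R).

Lemma limf_einf_right_gt0P f :
  (0 < limf_einf f 0^'+)%E <-> exists c t0 : R,
    [/\ 0 < c, 0 < t0 & forall t, 0 < t < t0 -> (c%:E <= f t)%E].
Proof.
rewrite limf_einfE; split=> [/ereal_sup_gt[_ [A FA <-]]|[c [t0 [c0 t00 h]]]].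
  move=> A0; have [c [c0 cA]] : exists c : R, 0 < c /\ (c%:E <= ereal_inf (f @` A))%E.
    move: A0; case: ereal_inf => [r|_|//]; last by exists 1; rewrite leey.
    by rewrite lte_fin => r0; exists r.
  have [e e0 eA] := FA; exists c, e; split=> // t /andP[tp te].
  apply: le_trans cA _; apply: ereal_inf_lbound; exists t => //; apply: eA => //=.
  by rewrite sub0r normrN gtr0_norm.
apply: (@lt_le_trans _ _ c%:E); first by rewrite lte_fin.
apply: (@le_trans _ _ (ereal_inf (f @` [set t | 0 < t < t0]))).
  by apply: le_ereal_inf_tmp => _ [t /= tt <-]; exact: h.
apply: ereal_sup_ubound; exists [set t | 0 < t < t0] => //.
have : \forall t \near (0 : R)^'+, 0 < t /\ t < t0.
  by near=> t; split; near: t; [exact: nbhs_right_gt|exact: nbhs_right_lt].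
by apply: filterS => t [? ?]; apply/andP.
Unshelve. all: end_near. Qed.

End liminf_kappa.

(** * Diagonal operators on the sequence space *)

Section ell2_multiplication.
Context {R : realType}.
Implicit Types (x y : ell2 R) (z : nat -> R[i]).

Lemma ell2_rnorm_sqr x : rnorm x ^+ 2 = limn (series (fun n => rnorm (x n) ^+ 2)).
Proof. by rewrite /rnorm ell2_normE/= sqr_sqrtr// ell2_sum_ge0. Qed.

Lemma ell2_rnorm_le x (c : R) : 0 <= c ->
  (forall n, \sum_(0 <= k < n) rnorm (x k) ^+ 2 <= c ^+ 2) -> rnorm x <= c.
Proof.
move=> c0 h; rewrite -(@ler_pXn2r _ 2%N)// ?nnegrE ?rnorm_ge0// ell2_rnorm_sqr.
by apply: limr_le; [exact: ell2P|exact: nearW].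
Qed.

Lemma ell2_coord_le x n : rnorm (x n) <= rnorm x.
Proof.
rewrite -(@ler_pXn2r _ 2%N)// ?nnegrE ?rnorm_ge0// ell2_rnorm_sqr.
apply: le_trans (ell2_sum_le x n.+1); rewrite big_nat_recr//= lerDr.
by apply: sumr_ge0 => i _; exact: sqr_ge0.
Qed.

Lemma ell2_rnorm_dom x y (c : R) : 0 <= c ->
  (forall n, rnorm (x n) <= c * rnorm (y n)) -> rnorm x <= c * rnorm y.
Proof.
move=> c0 xy; apply: ell2_rnorm_le => [|n]; first by rewrite mulr_ge0// rnorm_ge0.
rewrite exprMn ell2_rnorm_sqr (le_trans _ (ler_wpM2l (sqr_ge0 c) (ell2_sum_le y n)))//.
rewrite mulr_sumr; apply: ler_sum => k _; rewrite -exprMn.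
by rewrite lerXn2r ?nnegrE ?mulr_ge0 ?rnorm_ge0.
Qed.

Lemma ell2_ext x y : (forall n, x n = y n) -> x = y.
Proof. by move=> xy; apply/val_inj/funext. Qed.

Lemma rnorm_ell2_basis j : rnorm (ell2_basis j : ell2 R) = 1.
Proof.
apply/eqP; rewrite eq_le; apply/andP; split; last first.
  by apply: le_trans (ell2_coord_le _ j); rewrite /= eqxx crnorm1.
apply: ell2_rnorm_le => // n; rewrite expr1n.
rewrite (eq_bigr (fun k : nat => (k == j)%:R)) => [|k _]; last first.
  by rewrite /=; case: eqP => _; rewrite ?crnorm1 ?expr1n// /rnorm normr0 expr0n.
elim: n => [|n IH]; first by rewrite big_nil.
have [nj|jn] := leqP n j; last first.
  by rewrite big_nat_recr//= (gtn_eqF jn) addr0.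
rewrite big_nat_recr//= big_nat big1 ?add0r ?lern1 ?leq_b1//.
by move=> i /andP[_ ni]; rewrite ltn_eqF// (leq_trans ni).
Qed.

Lemma ell2_mul_subproof z x : (forall j, rnorm (z j) <= 1) ->
  (fun n => z n * x n) \in @ell2_pred R.
Proof.
move=> z1; apply/ell2_predP; rewrite /square_summable.
apply: (series_le_cvg _ _ _ (@ell2P R x)) => n; rewrite ?sqr_ge0//=.
by rewrite lerXn2r ?nnegrE ?rnorm_ge0// crnormM ler_piMl ?rnorm_ge0.
Qed.

Definition ell2_mul_fun z (z1 : forall j, rnorm (z j) <= 1) x : ell2 R :=
  Ell2 (ell2_mul_subproof x z1).

Lemma ell2_mul_linear z (z1 : forall j, rnorm (z j) <= 1) : linear (ell2_mul_fun z1).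
Proof. by move=> a x y; apply: ell2_ext => n /=; rewrite mulrDr mulrCA. Qed.

HB.instance Definition _ z (z1 : forall j, rnorm (z j) <= 1) :=
  GRing.isLinear.Build _ _ _ _ (ell2_mul_fun z1) (ell2_mul_linear z1).

Definition ell2_mul z (z1 : forall j, rnorm (z j) <= 1) : {linear ell2 R -> ell2 R} :=
  ell2_mul_fun z1.

(** The square norm of the tail is the remainder of the series of squares. *)
Lemma ell2_tail_cvg x (e : R) : 0 < e -> exists n : nat, forall m, (n <= m)%N ->
  rnorm (x - \sum_(j < m) x j *: ell2_basis j) <= e.
Proof.
move=> e0; have cx := @ell2P R x.
have e20 : 0 < e ^+ 2 by rewrite exprn_gt0.
have /cvgrPdist_lt/(_ _ e20)[n _ nP] := cx.
exists n => // m nm; have {nP} := nP m nm; rewrite /= => lm.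
have coord k : (x - \sum_(j < m) x j *: ell2_basis j) k = if (k < m)%N then 0 else x k.
  have -> : (x - \sum_(j < m) x j *: ell2_basis j) k =
      x k - \sum_(j < m) x j * (k == j)%:R.
    congr (_ - _); elim/big_ind2 : _ => // a b c d <- <-; by [].
  case: ltnP => km.
    rewrite (bigD1 (Ordinal km))//= eqxx mulr1 big1 ?addr0 ?subrr// => i ik.
    by rewrite (_ : (k == i) = false) ?mulr0//; apply: contraNF ik => /eqP ki;
      apply/eqP/val_inj.
  rewrite big1 ?subr0// => i _; rewrite gtn_eqF ?mulr0//.
  exact: leq_trans (ltn_ord i) km.
move: (x - _) coord => y coord; apply: ell2_rnorm_le (ltW e0) _ => M.
apply: le_trans (ltW lm); apply: le_trans (ler_norm _).
rewrite lerBrDl.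
apply: (@le_trans _ _ (\sum_(0 <= k < maxn m M) rnorm (x k) ^+ 2)); last exact: ell2_sum_le.
rewrite /series/= (@big_cat_nat _ _ _ m 0 (maxn m M))//= ?leq_maxl// lerD2l.
have [Mm|mM] := leqP M m.
  rewrite big_nat big1 => [|i /andP[_ iM]]; last first.
    by rewrite coord (leq_trans iM Mm) /rnorm normr0 expr0n.
  by apply: sumr_ge0 => i _; exact: sqr_ge0.
rewrite (@big_cat_nat _ _ _ m 0 M)//= ?(ltnW mM)//.
rewrite big_nat big1 ?add0r => [|i /andP[_ im]]; last first.
  by rewrite coord im /rnorm normr0 expr0n.
rewrite le_eqVlt; apply/orP; left; apply/eqP; apply: eq_big_nat => i /andP[mi _].
by rewrite coord ltnNge mi.
Qed.

(** The images of the basis determine a bounded operator because truncations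
    converge in norm. *)
Lemma diagonal_coord (T : {linear ell2 R -> ell2 R}) z x n :
  (opnorm T < +oo)%E -> (forall j, T (ell2_basis j) = z j *: ell2_basis j) ->
  T x n = z n * x n.
Proof.
move=> Tfin Tz.
have [M M0 TM] := opnorm_finP (linearZ_LR T) Tfin.
have /(opnorm_leP (linearZ_LR T) M0) {}TM : (opnorm T <= M%:E)%E by rewrite TM.
apply/eqP; rewrite -subr_eq0 -rnorm_eq0 eq_le rnorm_ge0 andbT.
apply/ler_addgt0Pr => e e0; rewrite add0r.
have eM : 0 < e / (M + 1) by rewrite divr_gt0// ltr_wpDl.
have [m0 /(_ (maxn m0 n.+1) (leq_maxl _ _))] := ell2_tail_cvg x eM.
set m := maxn m0 n.+1; have nm : (n < m)%N by rewrite leq_max ltnSn orbT.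
set y := x - _ => ye.
have -> : T x n - z n * x n = T y n.
  rewrite /y linearB linear_sum.
  rewrite -[RHS]/(T x n - (\sum_(i < m) T (x i *: ell2_basis i)) n).
  congr (_ - _).
  have -> : (\sum_(i < m) T (x i *: ell2_basis i)) n =
      \sum_(i < m) x i * (z i * (n == i)%:R).
    elim/big_ind2 : _ => // [a b c d <- <-|i _]; first by [].
    by rewrite linearZ Tz.
  rewrite (bigD1 (Ordinal nm))//= eqxx mulr1 mulrC big1 ?addr0// => i ik.
  by rewrite (_ : (n == i) = false) ?mulr0//; apply: contraNF ik => /eqP ki;
      apply/eqP/val_inj.
rewrite (le_trans (ell2_coord_le _ _))// (le_trans (TM y))//.
rewrite (le_trans (ler_wpM2l M0 ye))// mulrCA ler_piMr ?(ltW e0)//.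
by rewrite ler_pdivrMr ?ltr_wpDl// mul1r lerDl.
Qed.

Lemma ell2_mul_adjoint (T : {linear ell2 R -> ell2 R}) z
    (z1 : forall j, rnorm (Num.conj (z j)) <= 1) :
  (forall x n, T x n = z n * x n) -> is_adjoint (ell2_mul z1) T.
Proof.
move=> Tz x y; rewrite /inner/= /ell2_inner; congr csum; apply/funext => n.
rewrite Tz rmorphM mulrA (mulrC (z n)); congr (_ * _ * _).
exact: (esym (conjCK (z n))).
Qed.

Lemma diagonal_normal (T : {linear ell2 R -> ell2 R}) z :
  (forall j, rnorm (z j) <= 1) ->
  (forall x n, T x n = z n * x n) -> normal_op T /\ (opnorm T <= 1)%E.
Proof.
move=> z1 Tz; split; last first.
  apply/opnorm_leP; [exact: linearZ_LR|exact: ler01|move=> x].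
  apply: ell2_rnorm_dom => // n; rewrite Tz crnormM mul1r.
  by rewrite ler_piMl ?rnorm_ge0.
have zc1 j : rnorm (Num.conj (z j)) <= 1 by rewrite crnormJ.
exists (ell2_mul zc1); split.
- apply: (@le_lt_trans _ _ 1%E); last by rewrite ltry.
  apply/opnorm_leP; [exact: linearZ_LR|exact: ler01|move=> x].
  apply: ell2_rnorm_dom => // n; rewrite /= crnormM mul1r.
  by rewrite ler_piMl ?rnorm_ge0.
- exact: ell2_mul_adjoint.
- by move=> x; apply: ell2_ext => n /=; rewrite !Tz /= mulrCA.
Qed.

Lemma diagonal_contraction_normal (T : {linear ell2 R -> ell2 R}) :
  diagonal_contraction T -> normal_op T /\ (opnorm T <= 1)%E.
Proof.
move=> [Tfin [z [z1 Tz]]]; apply: (@diagonal_normal T z).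
  by move=> j; rewrite -rnorm_le1.
by move=> x n; exact: diagonal_coord.
Qed.

End ell2_multiplication.

(** * Diagonal contractions that are not Ritt *)

Section diagonal_not_ritt.
Context {R : realType}.
Implicit Types (z : nat -> R[i]).

Lemma diagonal_displacement (T : {linear ell2 R -> ell2 R}) z n x k :
  (forall x n, T x n = z n * x n) ->
  (x - iter n T x) k = (1 - z k ^+ n) * x k.
Proof.
move=> Tz; have -> : (x - iter n T x) k = x k - iter n T x k by [].
suff -> : iter n T x k = z k ^+ n * x k by rewrite mulrBl mul1r.
by elim: n => [|n IH]; rewrite ?expr0 ?mul1r//= Tz IH exprS mulrA.
Qed.

Lemma diagonal_spectrum (T : {linear ell2 R -> ell2 R}) z w (d : R) :
  (forall j, rnorm (z j) <= 1) ->
  (forall x n, T x n = z n * x n) -> 0 < d -> (forall j, d <= rnorm (w - z j)) ->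
  ~ spectrum T w.
Proof.
move=> z1 Tz d0 dw; have [nT T1] := diagonal_normal z1 Tz.
have Tfin : (opnorm T < +oo)%E by rewrite (le_lt_trans T1)// ltry.
move=> /(spectrum_approx_eigenvalue nT Tfin); apply/bounded_belowP.
exists d => // x; rewrite -ler_pdivlMl//.
apply: ell2_rnorm_dom => [|n]; first by rewrite invr_ge0 ltW.
rewrite ler_pdivlMl// -[(w *: x - T x) n]/(w * x n - T x n) Tz -mulrBl crnormM.
by rewrite ler_wpM2r// rnorm_ge0.
Qed.

(** The resolvent multiplies the basis vector [j] by [1 / (w - z j)]. *)
Lemma ritt_diagonal_bound (T : {linear ell2 R -> ell2 R}) z :
  (forall x n, T x n = z n * x n) -> ritt T ->
  exists M : R, forall w j, 1 < rnorm w -> rnorm (w - 1) <= M * rnorm (w - z j).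
Proof.
move=> Tz [_ specT]; set U := ereal_sup _ => Ufin.
have [M UM] : exists M : R, (U <= M%:E)%E.
  by case: U Ufin => [M _|//|_]; [exists M|exists 0; rewrite leNye].
exists M => w j w1.
have : ~ spectrum T w by move/specT => /=; rewrite rnorm_le1 leNgt w1.
move=> /contrapT /(xgetPex (fun=> 0)); rewrite -/(resolvent T w).
set S := resolvent T w => -[Slin Sfin _ SK].
have SZ := linear_scalable Slin.
have [r r0 Sr] := opnorm_finP SZ Sfin.
have rM : rnorm (w - 1) * r <= M.
  rewrite -lee_fin EFinM -Sr; apply: le_trans UM; apply: ereal_sup_ubound.
  by exists w => //=; rewrite crnorm_gt1.
have /(opnorm_leP SZ r0) /(_ (ell2_basis j)) : (opnorm S <= r%:E)%E by rewrite Sr.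
rewrite rnorm_ell2_basis mulr1 => Sj.
have : S ((w - z j) *: ell2_basis j) = ell2_basis j.
  rewrite -[RHS]SK; congr S; apply: ell2_ext => n.
  rewrite -[RHS]/(w * ell2_basis j n - T (ell2_basis j) n) Tz -mulrBl/=.
  rewrite -[LHS]/((w - z j) * (n == j)%:R).
  by case: eqP => [->//|_]; rewrite !mulr0.
rewrite SZ => /(congr1 rnorm); rewrite rnormZ rnorm_ell2_basis => e.
apply: le_trans (ler_wpM2r (rnorm_ge0 _) rM).
rewrite -mulrA ler_peMr ?rnorm_ge0// -e mulrC.
by rewrite ler_wpM2r// rnorm_ge0.
Qed.

Lemma eventually_lower_bound (f : nat -> R) (J : nat) (d : R) :
  0 < d -> (forall j, (J <= j)%N -> d <= f j) -> (forall j, 0 < f j) ->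
  exists2 e, 0 < e & forall j, e <= f j.
Proof.
elim: J d => [|J IH] d d0 df f0; first by exists d => // j; exact: df.
apply: (IH (Num.min d (f J))) => // [|j]; first by rewrite lt_min d0 f0.
rewrite leq_eqVlt => /predU1P[<-|Jj]; first by rewrite ge_min lexx orbT.
by rewrite ge_min df.
Qed.

(** Take [t_j] tending to [0] with [kappa (t_j) <= s_j], where
    [s_j = t_j / (j + 1)], and the eigenvalues [exp (- s_j) e^(i t_j)], which
    lie inside the disc, tend to [1] and have displacements at most [1].
    They approach the circle tangentially: at [w = (1 + s_j) e^(i t_j)],
    [|w - 1|] is of order [t_j] while the distance to the eigenvalue is at
    most [2 s_j], so the Ritt bound fails.  The eigenvalue [0] makes the
    displacement of every power exactly [1]. *)
Lemma exists_non_ritt_diagonal (N : set nat) :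
  N !=set0 -> (forall n, N n -> (0 < n)%N) ->
  (forall c t0 : R, 0 < c -> 0 < t0 ->
     exists2 t, 0 < t < t0 & (kappa N t <= (c * t)%:E)%E) ->
  exists T : {linear ell2 R -> ell2 R},
    [/\ diagonal_contraction T, peripheral_spectrum T `<=` [set 1],
        power_displacement N T = 1%E & ~ ritt T].
Proof.
move=> [n0 Nn0] Npos small.
have tex : forall j : nat, exists t : R, 0 < t < j.+1%:R^-1 /\
    (kappa N t <= (j.+1%:R^-1 * t)%:E)%E.
  move=> j.
  have j0 : 0 < j.+1%:R^-1 :> R by rewrite invr_gt0.
  by have [t ? ?] := small _ _ j0 j0; exists t.
have [t tP] := choice tex.
pose s j := j.+1%:R^-1 * t j.
have t0 j : 0 < t j by have [/andP[]] := tP j.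
have s0 j : 0 < s j by rewrite mulr_gt0 ?invr_gt0.
have tj j : t j < j.+1%:R^-1 by have [/andP[]] := tP j.
have jV1 j : j.+1%:R^-1 <= 1 :> R by rewrite invf_le1// ler1n.
have sj j : s j <= t j by rewrite ler_piMl// ltW.
pose z j : R[i] := if j is k.+1 then (expR (- s k))%:C * cis (t k) else 0.
have zS j : rnorm (z j.+1) = expR (- s j).
  by rewrite crnormM rnorm_cis mulr1 crnorm_real gtr0_norm ?expR_gt0.
have z0 : rnorm (z 0%N) = 0 by rewrite /rnorm normr0.
have z1 j : rnorm (z j) < 1.
  by case: j => [|j]; rewrite ?z0 ?ltr01// zS expR_lt1 oppr_lt0.
have z1' j : rnorm (z j) <= 1 by rewrite ltW.
pose T := ell2_mul z1'.
have Tz x n : T x n = z n * x n by [].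
have Tfin : (opnorm T < +oo)%E.
  by rewrite (le_lt_trans (diagonal_normal z1' Tz).2)// ltry.
have zN n j : N n -> rnorm (1 - z j ^+ n) <= 1.
  move=> Nn; case: j => [|j]; first by rewrite expr0n gtn_eqF ?Npos// subr0 crnorm1.
  have sj0 : 0 <= s j by rewrite ltW.
  by have [_] := tP j; move/(kappa_le_displacement Npos _ sj0); apply.
have dispZ n : scalable (fun x => x - iter n T x).
  by move=> a x; apply: ell2_ext => k; rewrite -[RHS]/(a * (x - iter n T x) k)
     !(diagonal_displacement _ _ _ Tz) /= mulrCA.
exists T; split.
- split=> //; exists z; split=> [j|j]; first by rewrite rnorm_le1.
  apply: ell2_ext => n; rewrite Tz -[RHS]/(z j * (n == j)%:R)/=.
  by case: eqP => [->//|_]; rewrite !mulr0.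
- move=> w [Tw /crnorm_norm1 w1]; apply: contrapT => /eqP wn1.
  have dw : 0 < rnorm (1 - w) by rewrite rnorm_gt0 subr_eq0 eq_sym.
  have [J Jw] : exists J : nat, forall j, (J <= j)%N -> 3 * j.+1%:R^-1 <= rnorm (1 - w) / 2.
    exists (Num.truncn (6 / rnorm (1 - w))) => j Jj.
    rewrite ler_pdivrMr// mulrAC ler_pdivlMr//.
    have : 6 / rnorm (1 - w) <= j.+1%:R.
      by rewrite ltW// (lt_le_trans (truncnS_gt _))// ler_nat.
    by rewrite ler_pdivrMr//; lra.
  have near1 j : rnorm (1 - z j.+1) <= 3 * j.+1%:R^-1.
    have -> : 1 - z j.+1 = (1 - cis (t j)) + (1 - expR (- s j))%:C * cis (t j).
      by rewrite rmorphB/= mulrBl mul1r addrA subrK.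
    rewrite (le_trans (rnormD _ _))// crnormM rnorm_cis mulr1 crnorm_real.
    have := rnorm_1Bcis (t j); rewrite (gtr0_norm (t0 j)).
    have e1 : expR (- s j) <= 1 by rewrite -zS.
    rewrite ger0_norm ?subr_ge0//.
    have := expR_ge1Dx (- s j); have := sj j; have := tj j. move: (j.+1%:R^-1) => v; lra.
  have far j : (J.+1 <= j)%N -> rnorm (1 - w) / 2 <= rnorm (w - z j).
    case: j => // k Jk; have := le_trans (near1 k) (Jw k Jk).
    by have := rnormB (1 - z k.+1) (w - z k.+1); rewrite opprB subrKA; lra.
  have dist0 j : 0 < rnorm (w - z j).
    by have := rnormBB w (z j); have := z1 j; rewrite w1; lra.
  have [e e0 ew] := eventually_lower_bound (divr_gt0 dw (ltr0n _ 2)) far dist0.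
  exact: diagonal_spectrum z1' Tz e0 ew Tw.
- apply/eqP; rewrite eq_le; apply/andP; split.
    apply: ge_ereal_sup => _ [n Nn <-]; apply/opnorm_leP; [exact: dispZ|exact: ler01|].
    move=> x; apply: ell2_rnorm_dom => // k.
    by rewrite (diagonal_displacement _ _ _ Tz) crnormM ler_wpM2r ?rnorm_ge0 ?zN.
  apply: (@le_trans _ _ (opnorm (fun x => x - iter n0 T x))); last first.
    by apply: ereal_sup_ubound; exists n0.
  apply: ereal_sup_ubound; exists (ell2_basis 0) => /=.
    by rewrite rnorm_le1 rnorm_ell2_basis.
  congr (_%:E); rewrite -[RHS](rnorm_ell2_basis 0); congr rnorm.
  apply: ell2_ext => k; rewrite (diagonal_displacement _ _ _ Tz) /=.
  by case: k => [|k]; rewrite ?mulr0// expr0n gtn_eqF ?Npos// subr0 mul1r.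
- move=> /(ritt_diagonal_bound Tz)[M MP].
  have [j jM] : exists j : nat, 2 * M / cos 1 < j.+1%:R.
    by exists (Num.truncn (2 * M / cos 1)); exact: truncnS_gt.
  rewrite ltr_pdivrMr ?cos1_gt0// in jM.
  pose w : R[i] := (1 + s j)%:C * cis (t j).
  have ws : rnorm w = 1 + s j.
    by rewrite crnormM rnorm_cis mulr1 crnorm_real gtr0_norm// addr_gt0.
  have w1 : 1 < rnorm w by rewrite ws ltrDl.
  have := MP w j.+1 w1.
  have -> : rnorm (w - z j.+1) = 1 + s j - expR (- s j).
    rewrite /w /= -mulrBl -rmorphB crnormM rnorm_cis mulr1 crnorm_real ger0_norm//.
    have := z1' j.+1; rewrite zS; have := s0 j; lra.
  have wlow : cos 1 * t j <= rnorm (w - 1).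
    apply: le_trans (sin_lower_bound _) _; first by rewrite t0 (le_trans (ltW (tj j))).
    have sin0 : 0 <= sin (t j).
      rewrite (le_trans _ (sin_lower_bound _))//.
        by rewrite mulr_ge0 ?(ltW (t0 j))// ltW// cos1_gt0.
      by rewrite t0 (le_trans (ltW (tj j))).
    apply: le_trans (rnorm_geIm (w - 1)); rewrite /w /= mul0r addr0 subr0.
    by rewrite ler_normr ler_peMl// lerDl ltW.
  have D0 : 0 < 1 + s j - expR (- s j).
    by have := z1 j.+1; rewrite zS; have := s0 j; lra.
  have D2 : 1 + s j - expR (- s j) <= 2 * s j by have := expR_ge1Dx (- s j); lra.
  move=> /(le_trans wlow) low.
  have M0 : 0 < M.
    by rewrite -(pmulr_lgt0 _ D0); apply: lt_le_trans low; rewrite mulr_gt0 ?cos1_gt0.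
  have := le_trans low (ler_wpM2l (ltW M0) D2).
  have <- : j.+1%:R * s j = t j by rewrite mulrA mulfV// mul1r.
  rewrite (mulrA (cos 1)) (mulrA M) ler_pM2r// (mulrC M) (mulrC (cos 1)).
  by rewrite leNgt jM.
Qed.

End diagonal_not_ritt.

(** * The equivalences *)

Theorem theorem7p5 (R : realType) (N : set nat)
    (Ninf : infinite_set N) (Npos : forall n, N n -> (0 < n)%N) :
  let cond_i :=
    forall (H : hilbertType R) (T : {linear H -> H}),
      normal_op T -> (opnorm T <= 1)%E ->
      peripheral_spectrum T `<=` [set 1] ->
      (power_displacement N T <= 1)%E ->
      ritt T in
  let cond_ii :=
    forall T : {linear ell2 R -> ell2 R},
      diagonal_contraction T ->
      peripheral_spectrum T `<=` [set 1] ->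
      (power_displacement N T <= 1)%E ->
      ritt T in
  let cond_iii :=
    (0%:E < limf_einf (fun t : R => kappa N t * (t^-1)%:E) 0^'+)%E in
  [/\ cond_i <-> cond_ii, cond_ii <-> cond_iii &
      ~ cond_iii ->
      exists T : {linear ell2 R -> ell2 R},
        [/\ diagonal_contraction T,
            peripheral_spectrum T `<=` [set 1],
            power_displacement N T = 1%E & ~ ritt T]].
Proof.
move=> cond_i cond_ii cond_iii.
have N0 : N !=set0.
  by apply/set0P/eqP => N0; apply: Ninf; rewrite N0; exact: finite_set0.
have i_ii : cond_i -> cond_ii.
  move=> ci T /diagonal_contraction_normal[nT T1]; exact: ci.
have iii_i : cond_iii -> cond_i.
  move=> /limf_einf_right_gt0P[c [t0 [c0 t00 ck]]] H T nT T1 Tper TN.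
  have [K K0 TK] := stolz_of_kappa Npos c0 t00 ck T1 Tper TN.
  exact: normal_contraction_ritt TK.
have niii : ~ cond_iii -> exists T : {linear ell2 R -> ell2 R},
    [/\ diagonal_contraction T, peripheral_spectrum T `<=` [set 1],
        power_displacement N T = 1%E & ~ ritt T].
  move=> nc; apply: exists_non_ritt_diagonal => // c t0 c0 t00.
  apply: contrapT => /forall2NP h; apply: nc; apply/limf_einf_right_gt0P.
  exists c, t0; split=> // t tt; have [//|/negP] := h t.
  have [tp _] := andP tt; rewrite -ltNge => /ltW ct.
  rewrite -(mulfK (lt0r_neq0 tp) c) EFinM lee_wpmul2r// lee_fin invr_ge0 ltW//.
have ii_iii : cond_ii -> cond_iii.
  move=> cii; apply: contrapT => /niii[T [dT Tper TN nT]].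
  by apply: nT; apply: cii; rewrite ?TN.
by split=> //; split=> //; [move=> /ii_iii|move=> ? ]; exact: iii_i || exact/i_ii/iii_i.
Qed.
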